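(* Let $L>0$ and $0<\underline\beta<\overline\beta\le1$ be given. There exists a constant $C_*>0$, depending only on $\underline\beta$, $\overline\beta$, $L$ and the constant $\eta$ bounding $F_X$ and $\sigma$, such that the following holds. Let $\alpha\in(0,1)$ and let $[\hat c,\infty)$ (with $\hat c=\hat c_n$ a function of the data $\{(X_i,Y_i)\}_{i=1}^n$) be any sequence of one-sided confidence intervals with asymptotic coverage $1-\alpha$ for $g(0)$ when $g\in\mathcal{G}_{|x|\downarrow}$, i.e. $\liminf_{n}\inf_{g\in\mathcal{G}_{|x|\downarrow}}P_g(g(0)\in[\hat c,\infty))\ge1-\alpha$. Then $$\limsup_{n\to\infty}\ \inf_{\beta\in[\underline\beta,\overline\beta]}\ \inf_{g\in\Sigma(L,\beta)\cap\mathcal{G}_{|x|\downarrow}} P_g\left(\hat c>g(0)-C_*(n/\log\log n)^{-\beta/(2\beta+1)}\right)\le\alpha .$$ Furthermore, for $\alpha\in(0,1)$, let $$\hat c^*=\max_{1\le k\le\overline k}\left[\hat g_k-\frac{c_{\alpha,n}}{\sqrt{k}}\right],$$ where $\overline k$ is the largest $k$ with $|X_{(k)}|<\eta$. The confidence interval $[\hat c^*,\infty)$ has coverage at least $1-\alpha$, i.e. $P_g(g(0)\in[\hat c^*,\infty))\ge1-\alpha$, for all $g\in\mathcal{G}_{|x|\downarrow}$, and there exists a constant $C^*$ such that, for all $\varepsilon\in(0,1]$, $$\lim_{n\to\infty}\ \inf_{\beta\in[\varepsilon,1]}\ \inf_{g\in\Sigma(L,\beta)\cap\mathcal{G}_{|x|\downarrow}}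 P_g\left(\hat c^*>g(0)-C^*(n/\log\log n)^{-\beta/(2\beta+1)}\right)=1 .$$
   Context: Model: for each $n$ (with $n\ge 3$ whenever $\log\log n$ appears) one observes i.i.d. pairs of real random variables $(X_i,Y_i)$, $i=1,\dots,n$, with $Y_i=g(X_i)+\varepsilon_i$, $\varepsilon_i\mid X_i\sim N(0,\sigma^2(X_i))$, $X_i\sim F_X$, where $F_X$ is a c.d.f. and $g:\mathbb{R}\to\mathbb{R}$ is the regression function. The distribution $F_X$ and the conditional variance function $\sigma^2$ are fixed and known, and for some $\eta>0$ they satisfy $$\eta t\le |F_X(t)-F_X(-t)|\le t/\eta,\qquad \eta\le\sigma^2(x)\le 1/\eta\qquad\text{for all } |x|<\eta,\ 0<t<\eta.$$ The point $0$ may be on the boundary of the support of $X_i$. $P_g$ denotes probability when the regression function is $g$. For $L>0$ and $0\le\beta\le1$, $\Sigma(L,\beta)=\{g:\ |g(x)-g(x')|\le L|x-x'|^\beta \text{ for all } x,x'\}$. $\mathcal{G}_{|x|\downarrow}$ is the class of functions that are nondecreasing on $(-\infty,0]$ and nonincreasing on $[0,\infty)$. Nearest neighbor estimator: for $k\in\{1,\dots,n\}$ let $|X_{(k)}|$ be the $k$th least value of $|X_1|,\dots,|X_n|$. With $\eta>0$ the same constant for which $F_X$ and $\sigma^2$ satisfy $\eta t\le |F_X(t)-F_X(-t)|\le t/\eta$ and $\eta\le\sigma^2(x)\le 1/\eta$ for all $|x|<\eta$, $0<t<\eta$, if $|X_{(k)}|<\eta$ then $\hat g_k$ is the average of the $k$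 values $Y_j$ whose $|X_j|$ are the $k$ smallest (ties among the $|X_j|$ broken by index), i.e. $\hat g_k=\frac1k\sum_{|X_j|\le|X_{(k)}|}Y_j$ in the absence of ties; $\hat g_k=0$ if $|X_{(k)}|\ge\eta$. The critical value $c_{\alpha,n}$ is the $1-\alpha$ quantile of $\max_{1\le k\le n}\sqrt{k}\,\hat g_k$ under $g\equiv0$. If no $k$ satisfies $|X_{(k)}|<\eta$, then $\hat c^*=-\infty$ (the confidence interval is the whole line). *)

(* Defs.v *)
From HB Require Import structures.
From mathcomp Require Import all_boot all_order all_algebra.
From mathcomp Require Import all_classical all_reals all_analysis.
From mathcomp Require Import measurable_realfun.

Set Implicit Arguments.
Unset Strict Implicit.
Unset Printing Implicit Defensive.

Import Order.TTheory GRing.Theory Num.Theory.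
Import numFieldNormedType.Exports.

Local Open Scope classical_set_scope.
Local Open Scope ring_scope.

(* The library's measures on the line live on [measurableTypeR R], whose
   sigma-algebra is the Borel one but whose display differs from that of [R];
   they are transported to [R] along the identity. *)
Section borel_id.
Context {R : realType}.

Definition borel_id : measurableTypeR R -> R := idfun.

HB.instance Definition _ := @isMeasurableFun.Build _ _ _ _ borel_id
  (@measurable_id _ (measurableTypeR R) setT).

Definition law_of_cdf (F : cumulativeBounded (0 : R) (1 : R)) :
    probability R R :=
  distribution (lebesgue_stieltjes_measure F) borel_id.

(* [normal_prob m 0] is not the point mass at [m] in the library, hence the
   case distinction. *)
Definition centered_normal (v : R) : probability R R :=
  if v <= 0 then (\d_(0 : R) : probability R R)
  else distribution (normal_prob 0 (Num.sqrt v)) borel_id.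

End borel_id.

Section noise_kernel.
Context {R : realType}.
Local Open Scope ereal_scope.

Let h (U : set R) (p : R * measurableTypeR R) : R :=
  (((p.1 * (pi *+ 2)) `^ (- 2^-1)) *
   expR (- ((p.2 ^+ 2) * ((p.1 * 2) `^ (-1)))) * \1_U (p.2 : R))%R.

Lemma measurable_centered_normal (U : set R) : measurable U ->
  measurable_fun [set: R] (fun v => centered_normal v U).
Proof.
move=> mU.
have m2 : measurable_fun [set: R * measurableTypeR R] (fun p => p.2 : R).
  by move=> ? ? ?; apply: measurable_snd.
have mh : measurable_fun [set: R * measurableTypeR R] (EFin \o h U).
  apply/measurable_EFinP; apply: measurable_funM.
    apply: measurable_funM.
      apply: (@measurableT_comp _ _ _ _ _ _ (fun x : R => x `^ (- 2^-1))%R _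
        (fun p : R * measurableTypeR R => p.1 * (pi *+ 2))%R) => //.
      by apply: measurable_funM.
    apply: measurableT_comp => //.
    apply: (@measurableT_comp _ _ _ _ _ _ (-%R : R -> R) _
      (fun p : R * measurableTypeR R => p.2 ^+ 2 * (p.1 * 2) `^ (-1))%R) => //.
    apply: measurable_funM; first exact: measurable_funX.
    apply: (@measurableT_comp _ _ _ _ _ _ (fun x : R => x `^ (-1))%R _
      (fun p : R * measurableTypeR R => p.1 * 2)%R) => //.
    by apply: measurable_funM.
  apply: (@measurableT_comp _ _ _ _ _ _ (\1_U : R -> R) _
    (fun p : R * measurableTypeR R => p.2 : R)) => //.
rewrite [X in measurable_fun _ X](_ : _ = (fun v : R => if (v <= 0)%R then
    \d_(0%R : R) U else
    \int[@lebesgue_measure R]_z (EFin \o h U) (v, z))); last first.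
  apply/funext => v; rewrite /centered_normal; case: ifPn => //.
  rewrite -ltNge => v0.
  have s0 : Num.sqrt v != 0%R by rewrite gt_eqF// sqrtr_gt0.
  rewrite /= /distribution /pushforward /= /normal_prob integral_mkcond.
  apply: eq_integral => z _.
  rewrite epatch_indic/= -EFinM /h/=; congr (_ * _)%:E.
  rewrite normal_pdfE// /normal_peak /normal_fun sqr_sqrtr ?ltW// subr0.
  rewrite powRN powR12_sqrt; last first.
    by apply: mulr_ge0; [exact: ltW|apply: mulrn_wge0; exact: pi_ge0].
  rewrite powR_inv1; last by apply: mulr_ge0 => //; exact: ltW.
  by rewrite [(v * 2)%R]mulr_natr [(v * (pi *+ 2))%R]mulrnAr [(- _ / _)%R]mulNr.
apply: measurable_fun_ifT => //.
  exact: (measurable_fun_ler (f := id) (g := cst 0%R)).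
have h0 p : 0 <= (EFin \o h U) p.
  by rewrite lee_fin !mulr_ge0// ?powR_ge0 ?expR_ge0.
exact: (measurable_fun_fubini_tonelli_F (m2 := lebesgue_measure) _ mh h0).
Qed.

Section error_kernel.
Variable v : {mfun R >-> R}.

Definition error_kernel (p : unit * R) : {measure set R -> \bar R} :=
  centered_normal (v p.2).

Let measurable_error_kernel U : measurable U ->
  measurable_fun [set: unit * R] (error_kernel ^~ U).
Proof.
move=> mU; apply: (measurableT_comp (measurable_centered_normal mU)).
exact: measurableT_comp.
Qed.

HB.instance Definition _ :=
  isKernel.Build _ _ _ _ _ error_kernel measurable_error_kernel.

Let error_kernelT p : error_kernel p setT = 1.
Proof. exact: probability_setT. Qed.

HB.instance Definition _ :=
  Kernel_isProbability.Build _ _ _ _ _ error_kernel error_kernelT.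

End error_kernel.

Definition pair_law (F : cumulativeBounded (0%R : R) (1%R : R))
    (v : {mfun R >-> R}) : set (R * R) -> \bar R :=
  mkproduct (kprobability (measurable_cst (law_of_cdf F : pprobability R R)))
    (error_kernel v) tt.

Section pair_law.
Variables (F : cumulativeBounded (0%R : R) (1%R : R)) (v : {mfun R >-> R}).

HB.instance Definition _ := Measure.on (pair_law F v).

Lemma pair_lawX (A B : set R) : measurable A -> measurable B ->
  pair_law F v (A `*` B) =
  \int[law_of_cdf F]_(x in A) centered_normal (v x) B.
Proof.
move=> mA mB; rewrite integral_mkcond /pair_law /=.
apply: eq_integral => x _; rewrite patchE.
rewrite kernel.intker_indicE; last exact: measurableX.
case: ifPn => xA; first by rewrite in_xsectionX.
by rewrite notin_xsectionX// measure0.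
Qed.

Let pair_lawT : pair_law F v setT = 1.
Proof.
rewrite -setXTT pair_lawX//.
rewrite (eq_integral (cst 1)); last by move=> x _; exact: probability_setT.
by rewrite integral_cst// mul1e; exact: probability_setT.
Qed.

HB.instance Definition _ :=
  Measure_isProbability.Build _ _ _ (pair_law F v) pair_lawT.

End pair_law.

End noise_kernel.

Section iid_law.
Context {d : measure_display} {T : measurableType d} {R : realType}.
Local Open Scope ereal_scope.

Definition tcons n (p : T * n.-tuple T) : n.+1.-tuple T :=
  [tuple of p.1 :: p.2].

HB.instance Definition _ n := @isMeasurableFun.Build _ _ _ _ (@tcons n)
  (measurable_cons measurable_fst measurable_snd).

Fixpoint iid_law (P : probability T R) n : probability (n.-tuple T) R :=
  match n return probability (n.-tuple T) R with
  | 0%N => \d_([tuple] : 0.-tuple T)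
  | n'.+1 => distribution (P \x iid_law P n') (@tcons n')
  end.

Lemma measurable_tuple_box n (A : 'I_n -> set T) :
  (forall i, measurable (A i)) ->
  measurable [set t : n.-tuple T | forall i, A i (tnth t i)].
Proof.
move=> mA; rewrite [X in measurable X](_ : _ =
    \bigcap_(i in [set: 'I_n]) ((tnth (T := T) ^~ i) @^-1` A i)).
  apply: fin_bigcap_measurable => [|i _]; first exact: finite_finset.
  by rewrite -[X in measurable X]setTI; exact: measurable_tnth.
by apply/seteqP; split => t /= At i; [move=> _|]; exact: At.
Qed.

Lemma iid_lawX (P : probability T R) n (A : 'I_n -> set T) :
  (forall i, measurable (A i)) ->
  iid_law P n [set t | forall i, A i (tnth t i)] = \prod_(i < n) P (A i).
Proof.
elim: n A => [|n IHn] A mA.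
  rewrite big_ord0 /= diracE mem_set//=; by case.
rewrite big_ord_recl /= /distribution /pushforward /=.
rewrite (_ : _ @^-1` _ = A ord0 `*`
    [set t : n.-tuple T | forall i, A (lift ord0 i) (tnth t i)]).
  rewrite product_measure1E; [|exact: mA|].
    congr (_ * _); exact: (IHn (fun i => A (lift ord0 i))).
  exact: (measurable_tuple_box (A := fun i => A (lift ord0 i))).
apply/seteqP; split => -[x t] /=.
  move=> At; split; first exact: (At ord0).
  by move=> i; have := At (lift ord0 i); rewrite tnthS.
move=> [Ax At] i; case: (unliftP ord0 i) => [j ->|->] //.
by rewrite tnthS; exact: At.
Qed.

End iid_law.

Section regression_model.
Context {R : realType}.
Implicit Types (F : cumulativeBounded (0 : R) (1 : R)) (v : {mfun R >-> R}).
Implicit Types (g : R -> R) (L beta eta alpha : R) (n k : nat).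

(* The joint law of the pairs (X_i, eps_i) does not involve [g]; the
   observations are obtained from it by setting Y_i = g(X_i) + eps_i. *)
Definition observations g n (s : n.-tuple (R * R)) : n.-tuple (R * R) :=
  [tuple of [seq (p.1, g p.1 + p.2) | p <- s]].

Definition Prob F v g n (A : set (n.-tuple (R * R))) : \bar R :=
  iid_law (pair_law F v) n (observations g (n := n) @^-1` A).

Definition local_bounds eta F v : Prop :=
  (forall t, 0 < t < eta -> eta * t <= `|F t - F (- t)| <= t / eta) /\
  (forall x, `|x| < eta -> eta <= v x <= eta^-1).

Definition holder_class L beta : set (R -> R) :=
  [set g | forall x x', `|g x - g x'| <= L * `|x - x'| `^ beta].

Definition unimodal_class : set (R -> R) :=
  [set g | (forall x y, x <= y -> y <= 0 -> g x <= g y) /\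
           (forall x y, 0 <= x -> x <= y -> g y <= g x)].

Definition rate n beta : R :=
  (n%:R / ln (ln n%:R)) `^ (- (beta / (2 * beta + 1))).

Section nearest_neighbor.
Variables (n : nat) (s : n.-tuple (R * R)).

Let absX (i : 'I_n) : R := `|(tnth s i).1|.

(* |X_(k)|, with k counted from 1 *)
Definition absX_order k : R :=
  nth 0 (sort <=%R [seq absX i | i <- enum 'I_n]) k.-1.

(* position, counted from 1, of the j-th observation when sorting by |X_j|,
   ties being broken by index *)
Definition absX_rank (j : 'I_n) : nat :=
  #|[set i | (absX i < absX j) || ((absX i == absX j) && (i <= j)%N)]|.

Definition ghat eta k : R :=
  if absX_order k < eta
  then (\sum_(j < n | (absX_rank j <= k)%N) (tnth s j).2) / k%:R
  else 0.

(* 0 when no [k] qualifies *)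
Definition kbar eta : nat := \max_(1 <= k < n.+1 | absX_order k < eta) k.

End nearest_neighbor.

Definition crit_value eta F v alpha n : R :=
  inf [set t : R | ((1 - alpha)%:E <= Prob F v (fun=> 0%R)
    [set s : n.-tuple (R * R) |
      \big[maxe/-oo]_(1 <= k < n.+1) (Num.sqrt k%:R * ghat s eta k)%:E
        <= t%:E])%E].

Definition chat_star eta F v alpha n (s : n.-tuple (R * R)) : \bar R :=
  (\big[maxe/-oo]_(1 <= k < (kbar s eta).+1)
     (ghat s eta k - crit_value eta F v alpha n / Num.sqrt k%:R)%:E)%E.

End regression_model.

(* Main.v *)
(* Upper bound.  Ranked by |X_i|, the errors form, conditionally on the X_i, a
   Gaussian random walk, so the product of the variables
   exp (l eps_i - l^2 v(X_i) / 2) over the k nearest neighbours is a martingale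
   in k.  Ville's inequality on each block 2^j <= k < 2^(j+1), and a union bound
   over the O(ln n) blocks, give a critical value of order sqrt (ln ln n).
   Averaging over the order of n t neighbours, with t = (n / ln ln n)^(-1/(2b+1)),
   then balances the bias t^b against the noise sqrt (ln ln n / (n t)).
   Coverage holds because a unimodal g is at most g 0.

   Lower bound.  Put about sqrt (ln n) smoothness levels b on a regular grid, and
   for each one a bump of height C r_b and half-width at most t_b.  Likelihood
   ratios against g = 0 of distinct bumps are nearly uncorrelated, since the ratio
   of two bandwidths is exponentially small in sqrt (ln n), while a single one has
   second moment at most (ln n)^(1/8).  Hence the average likelihood ratio tends
   to 1 in L^2, and no event of probability alpha + o(1) under g = 0 can have
   larger probability under all the bumps. *)
From HB Require Import structures.
Require Import Defs.
From mathcomp Require Import all_boot all_order all_algebra.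
From mathcomp Require Import all_classical all_reals all_analysis.
From mathcomp Require Import measurable_realfun ring lra.
Import Order.TTheory GRing.Theory Num.Theory.
Import numFieldNormedType.Exports.
Local Open Scope classical_set_scope.
Local Open Scope ring_scope.
Set Implicit Arguments.
Unset Strict Implicit.
Unset Printing Implicit Defensive.

(** One identity does most of the work: weighting N(0, w) by exp (l e - l^2 w / 2) is the same as
    translating it by l w. Applied to a single noise, it replaces conditional expectation and yields
    the martingale property. Applied to all noises with slope g / v, it gives the density of the law
    under [g] with respect to the law under 0. Applied to a product of two tilts, it gives the
    second moments. The obstacle is that [v] is controlled only within [eta] of 0 and may vanish
    elsewhere. Hence deviation bounds concern only ranks [k <= ncount s eta], and the alternatives
    must be supported in that neighbourhood. The number m of bumps, of order sqrt (ln n), answers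
    two opposite demands. The diagonal second moments, of size (ln n)^(1/8), must be negligible
    against m. The gaps between the values 1 / (2 beta + 1), of order 1 / m, must stay large after
    multiplication by ln (n / ln ln n), so that the off-diagonal exponents, which carry a factor ln
    ln n, still vanish. *)

(** * Mixtures and densities *)

Section mixture.
Context d1 d2 (X : measurableType d1) (Y : measurableType d2) (R : realType).
Variables (mu : {measure set X -> \bar R}) (nu : {measure set Y -> \bar R}).
Variable k : X -> {measure set Y -> \bar R}.
Hypothesis mk : forall U, measurable U -> measurable_fun [set: X] (k ^~ U).
Hypothesis nuE : forall U, measurable U -> nu U = (\int[mu]_x k x U)%E.
Local Open Scope ereal_scope.

Import HBNNSimple.

Let mixture_nnsfun (f : {nnsfun Y >-> R}) :
  \int[nu]_y (f y)%:E = \int[mu]_x \int[k x]_y (f y)%:E.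
Proof.
have int_nnsfun (m : {measure set Y -> \bar R}) : \int[m]_y (f y)%:E =
    \sum_(r \in range f) r%:E * m (f @^-1` [set r]).
  by rewrite integralT_nnsfun sintegralE.
rewrite int_nnsfun; under [RHS]eq_integral do rewrite int_nnsfun.
rewrite ge0_integral_fsum//; last 2 first.
- by move=> r; apply: measurable_funeM; exact: mk.
- by move=> r x _; exact: (mulemu_ge0 (fun r => f @^-1` [set r]))
    (@preimage_nnfun0 _ _ f r).
apply: eq_fsbigr => r _; have [r0|r0] := leP 0%R r.
  by rewrite ge0_integralZl// ?nuE//; exact: mk.
rewrite preimage_nnfun0// measure0 mule0 integral0_eq// => x _.
by rewrite measure0 mule0.
Qed.

(** Two instances are needed: weighted point masses give integration against a density, and the
    images of the conditional noise laws under [pair x] give iterated integration for [pair_law]. *)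
Lemma ge0_integral_mixture (f : Y -> \bar R) :
  (forall y, 0 <= f y) -> measurable_fun [set: Y] f ->
  \int[nu]_y f y = \int[mu]_x \int[k x]_y f y.
Proof.
move=> f0 mf; pose h := nnsfun_approx measurableT mf.
have mh n : measurable_fun [set: Y] (EFin \o h n) by exact/measurable_EFinP.
have h0 n y : 0 <= (h n y)%:E by rewrite lee_fin.
have hnd y : {homo (fun n => (h n y)%:E) : m n / (m <= n)%N >-> m <= n}.
  by move=> m n mn; rewrite lee_fin; exact/lefP/nd_nnsfun_approx.
have int_lim (m : {measure set Y -> \bar R}) :
    \int[m]_y f y = limn (fun n => \int[m]_y (h n y)%:E).
  rewrite -monotone_convergence//.
  by apply: eq_integral => y _; apply/esym/cvg_lim => //; exact: cvg_nnsfun_approx.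
rewrite int_lim; under [RHS]eq_integral do rewrite int_lim.
under eq_fun do rewrite mixture_nnsfun.
rewrite monotone_convergence//.
- by move=> n; apply: measurable_fun_integral_kernel => //; exact: mh.
- by move=> n x _; apply: integral_ge0.
- by move=> x _ m n mn; apply: ge0_le_integral; [by []|by []|exact: mh|
    exact: mh|by move=> y _; exact: hnd].
Qed.

End mixture.

Lemma ge0_integral_density d (T : measurableType d) (R : realType)
    (mu nu : {measure set T -> \bar R}) (l : T -> R) (f : T -> \bar R) :
  (forall x, 0 <= l x) -> measurable_fun [set: T] l ->
  (forall A, measurable A -> nu A = \int[mu]_(x in A) (l x)%:E)%E ->
  (forall x, 0 <= f x)%E -> measurable_fun [set: T] f ->
  (\int[nu]_x f x = \int[mu]_x ((l x)%:E * f x))%E.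
Proof.
move=> l0 ml nuE f0 mf.
(* A measure with density [l] is the mixture of the point masses at [x] with weights [l x]. *)
pose k (x : T) : {measure set T -> \bar R} := mscale (NngNum (l0 x)) \d_x.
rewrite (@ge0_integral_mixture _ _ _ _ _ mu nu k)//.
- apply: eq_integral => x _; rewrite ge0_integral_mscale//.
  by rewrite integral_dirac// diracT mul1e.
- move=> U mU; rewrite /k /mscale/=; apply: emeasurable_funM.
    exact/measurable_EFinP.
  exact/measurable_EFinP/measurable_indic.
- move=> U mU; rewrite nuE// integral_mkcond; apply: eq_integral => x _.
  by rewrite epatch_indic.
Qed.

(** * Gaussian tilting *)

Section gaussian.
Context {R : realType}.
Local Open Scope ereal_scope.

Lemma ge0_integral_translation (a : R) (f : R -> \bar R) :
  measurable_fun [set: R] f -> (forall x, 0 <= f x) ->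
  \int[@lebesgue_measure R]_x f (x + a)%R = \int[@lebesgue_measure R]_x f x.
Proof.
move=> mf f0.
have mT : measurable_fun [set: measurableTypeR R]
    ((fun x => x + a)%R : measurableTypeR R -> measurableTypeR R).
  exact: measurable_funD.
pose T : {mfun measurableTypeR R >-> measurableTypeR R} :=
  HB.pack (fun x : R => x + a)%R (isMeasurableFun.Build _ _ _ _ _ mT).
have shiftE (A : set R) : measurable A ->
    pushforward lebesgue_measure T A = lebesgue_measure A.
  move=> mA; apply/esym/lebesgue_measure_unique => //= _ [[b c]] _ <-.
  rewrite /pushforward (_ : _ @^-1` _ = `](b - a)%R, (c - a)%R]%classic).
    by rewrite !lebesgue_measure_itv/= !lte_fin ltrD2r -!EFinB opprB addrA subrK.
  by apply/seteqP; split => x /=; rewrite !in_itv/= ltrBlDr lerBrDr.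
transitivity (\int[pushforward lebesgue_measure T]_x f x).
  by rewrite ge0_integral_pushforward.
by apply: eq_measure_integral => A mA _; exact: shiftE.
Qed.

Lemma ge0_integral_centered_normal (w : R) (f : R -> \bar R) : (0 < w)%R ->
  measurable_fun [set: R] f -> (forall x, 0 <= f x) ->
  \int[centered_normal w]_x f x =
  \int[@lebesgue_measure R]_x ((normal_pdf 0 (Num.sqrt w) x)%:E * f x).
Proof.
move=> w0 mf f0; rewrite /centered_normal leNgt w0/=.
rewrite ge0_integral_distribution//.
rewrite (@ge0_integral_density _ _ _ lebesgue_measure _
  (normal_pdf 0 (Num.sqrt w)))//.
- exact: normal_pdf_ge0.
- exact: measurable_normal_pdf.
Qed.

(** Complete the square: -x^2/(2w) + l x - l^2 w/2 = -(x - l w)^2/(2w), then translate Lebesgue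
    measure. The degenerate case [w = 0] must be covered because [v] may vanish away from 0; both
    sides are then [f 0]. *)
Lemma gaussian_tilt (w l : R) (f : R -> \bar R) : (0 <= w)%R ->
  measurable_fun [set: R] f -> (forall x, 0 <= f x) ->
  \int[centered_normal w]_x ((expR (l * x - l ^+ 2 * w / 2))%:E * f x) =
  \int[centered_normal w]_x f (x + l * w)%R.
Proof.
move=> w0 mf f0; have mexp : measurable_fun [set: R] (fun x => (expR (l * x - l ^+ 2 * w / 2))%:E).
  apply/measurable_EFinP; apply: measurableT_comp => //.
  exact: measurable_funB.
have [w_gt0|w_le0] := ltP 0%R w; last first.
  move: mexp; have {w0 w_le0} -> : w = 0%R by apply/le_anti; rewrite w0 w_le0.
  move=> mexp.
  rewrite /centered_normal lexx !integral_dirac//; last 2 first.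
  - by under eq_fun do rewrite mulr0 addr0.
  - exact: emeasurable_funM.
  by rewrite !mulr0 mul0r subr0 expR0 addr0 mul1e.
have mshift : measurable_fun [set: R] (fun x => f (x + l * w)%R).
  by apply: measurableT_comp => //; exact: measurable_funD.
rewrite !ge0_integral_centered_normal//; last 2 first.
- exact: emeasurable_funM.
- by move=> x; rewrite mule_ge0// lee_fin expR_ge0.
rewrite -[RHS](@ge0_integral_translation (- (l * w))%R); last 2 first.
- apply: emeasurable_funM => //; apply/measurable_EFinP.
  exact: measurable_normal_pdf.
- by move=> x; rewrite mule_ge0// lee_fin normal_pdf_ge0.
apply: eq_integral => x _; rewrite subrK muleA -EFinM; congr (_%:E * _).
have s0 : Num.sqrt w != 0%R by rewrite gt_eqF// sqrtr_gt0.
rewrite !normal_pdfE// /normal_fun sqr_sqrtr// -[LHS]mulrA -expRD.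
congr (_ * expR _)%R; rewrite !subr0 mulr2n; field.
by rewrite gt_eqF// addr_gt0.
Qed.

End gaussian.

Section pair_law_integral.
Context {R : realType}.
Variables (F : cumulativeBounded (0%R : R) (1%R : R)) (v : {mfun R >-> R}).
Local Open Scope ereal_scope.

Lemma ge0_integral_pair_law (f : R * R -> \bar R) :
  measurable_fun [set: R * R] f -> (forall p, 0 <= f p) ->
  \int[pair_law F v]_p f p =
  \int[law_of_cdf F]_x \int[centered_normal (v x)]_e f (x, e).
Proof.
move=> mf f0.
have mpair (x : R) : measurable_fun [set: R] (pair x : R -> R * R).
  exact: pair1_measurable.
pose k' (x : R) : {measure set (R * R) -> \bar R} :=
  pushforward (centered_normal (v x)) (pair x).
pose k := k' mpair.
rewrite (@ge0_integral_mixture _ _ _ _ _ (law_of_cdf F) (pair_law F v) k)//.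
- by apply: eq_integral => x _; rewrite ge0_integral_pushforward.
- move=> U mU.
  rewrite (_ : (fun x => k x U) =
      (fun x => kernel.intker_indic (error_kernel v) U (tt, x))).
    apply: (@measurableT_comp _ _ _ _ _ _
      (kernel.intker_indic (error_kernel v) U) _ (pair tt)) => //.
    exact: kernel.measurable_intker_indic.
  apply/funext => x; rewrite kernel.intker_indicE// /k /k' /pushforward/=.
  by rewrite xsectionE.
- move=> U mU; rewrite /pair_law /=.
  apply: eq_integral => x _.
  by rewrite kernel.intker_indicE// /k /k' /pushforward/= xsectionE.
Qed.

(** The slope may depend on the design point, so [l = g / v] moves the regression function from 0 to
    [g], while a constant slope suits the exponential martingale. *)
Lemma pair_law_tilt (l : R -> R) (f : R * R -> \bar R) :
  (forall x, (0 <= v x)%R) -> measurable_fun [set: R] l ->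
  measurable_fun [set: R * R] f -> (forall p, 0 <= f p) ->
  \int[pair_law F v]_p
     ((expR (l p.1 * p.2 - l p.1 ^+ 2 * v p.1 / 2))%:E * f p) =
  \int[pair_law F v]_p f (p.1, p.2 + l p.1 * v p.1)%R.
Proof.
move=> v0 ml mf f0.
have ml1 : measurable_fun [set: R * R] (fun p => l p.1).
  exact: measurableT_comp.
have mv1 : measurable_fun [set: R * R] (fun p => v p.1).
  exact: measurableT_comp.
rewrite !ge0_integral_pair_law//.
- apply: eq_integral => x _.
  apply: (@gaussian_tilt _ _ (l x) (fun e => f (x, e))) => //.
  exact: (measurableT_comp mf).
- apply: measurableT_comp => //; apply/measurable_fun_pairP; split => //=.
    exact: measurable_fst.
  apply: (@measurable_funD _ _ _ _ (fun p : R * R => p.2)) => //.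
    exact: measurable_snd.
  exact: (measurable_funM ml1 mv1).
- apply: emeasurable_funM => //; apply/measurable_EFinP.
  apply: measurableT_comp => //; apply: measurable_funB.
    exact: measurable_funM.
  apply: measurable_funM => //; apply: measurable_funM => //.
  exact: measurable_funX.
- by move=> p; rewrite mule_ge0// lee_fin expR_ge0.
Qed.

End pair_law_integral.

(** * Independent samples *)

Section iid.
Context d (T : measurableType d) (R : realType) (P : probability T R).
Local Open Scope ereal_scope.

Lemma ge0_integral_iidS n (f : n.+1.-tuple T -> \bar R) :
  measurable_fun [set: n.+1.-tuple T] f -> (forall s, 0 <= f s) ->
  \int[iid_law P n.+1]_s f s =
  \int[P]_x \int[iid_law P n]_t f (tcons (x, t)).
Proof.
move=> mf f0 /=; rewrite ge0_integral_distribution//.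
rewrite fubini_tonelli1//.
- exact: (measurableT_comp mf).
- by move=> p; exact: f0.
Qed.

(** The hypothesis on [l i] says that it is the density of the image of [P] under [phi i]; densities
    of independent coordinates multiply. Letting [phi] vary with the index allows tilting one
    coordinate only as well as all of them. *)
Lemma iid_tilt n (phi : 'I_n -> T -> T) (l : 'I_n -> T -> R)
    (f : n.-tuple T -> \bar R) :
  (forall i, measurable_fun [set: T] (phi i)) ->
  (forall i, measurable_fun [set: T] (l i)) -> (forall i x, (0 <= l i x)%R) ->
  (forall i (h : T -> \bar R), measurable_fun [set: T] h ->
    (forall x, 0 <= h x) ->
    \int[P]_x ((l i x)%:E * h x) = \int[P]_x h (phi i x)) ->
  measurable_fun [set: n.-tuple T] f -> (forall s, 0 <= f s) ->
  \int[iid_law P n]_s ((\prod_(i < n) l i (tnth s i))%:E * f s) =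
  \int[iid_law P n]_s f [tuple phi i (tnth s i) | i < n].
Proof.
elim: n phi l f => [|n IHn] phi l f mphi ml l0 tilt mf f0.
  apply: eq_integral => s _; rewrite big_ord0 mul1e; congr f.
  by rewrite [LHS]tuple0 [RHS]tuple0.
have mmap : measurable_fun [set: n.+1.-tuple T]
    (fun s => [tuple phi i (tnth s i) | i < n.+1]).
  apply/measurable_fun_tnthP => i.
  rewrite (_ : _ \o _ = phi i \o @tnth _ T ^~ i); last first.
    by apply/funext => s /=; rewrite tnth_mktuple.
  by apply: measurableT_comp => //; exact: measurable_tnth.
have mprod : measurable_fun [set: n.+1.-tuple T]
    (fun s => (\prod_(i < n.+1) l i (tnth s i))%:E).
  apply/measurable_EFinP; apply: measurable_prod => i _.
  by apply: measurableT_comp => //; exact: measurable_tnth.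
rewrite !ge0_integral_iidS//; last 3 first.
- exact: (measurableT_comp mf).
- exact: emeasurable_funM.
- by move=> s; rewrite mule_ge0// lee_fin prodr_ge0.
(* The tail coordinates are shifted first, by induction, inside the integral; the head is tilted
   afterwards. *)
pose h x := \int[iid_law P n]_t
  f (tcons (x, [tuple phi (lift ord0 i) (tnth t i) | i < n])).
have mapE x t : [tuple phi i (tnth (tcons (x, t)) i) | i < n.+1] =
    tcons (phi ord0 x, [tuple phi (lift ord0 i) (tnth t i) | i < n]).
  apply: eq_from_tnth => i; rewrite tnth_mktuple.
  case: (unliftP ord0 i) => [j ->|->]; last by [].
  by rewrite /tcons/= !tnthS tnth_mktuple.
have mapn : measurable_fun [set: n.-tuple T]
    (fun t => [tuple phi (lift ord0 i) (tnth t i) | i < n]).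
  apply/measurable_fun_tnthP => i.
  rewrite (_ : _ \o _ = phi (lift ord0 i) \o @tnth _ T ^~ i); last first.
    by apply/funext => s /=; rewrite tnth_mktuple.
  by apply: measurableT_comp => //; exact: measurable_tnth.
have mft x : measurable_fun [set: n.-tuple T] (fun t => f (tcons (x, t))).
  apply: (measurableT_comp mf); apply: (@measurableT_comp _ _ _ _ _ _ (@tcons _ _ n)) => //.
transitivity (\int[P]_x ((l ord0 x)%:E * h x)).
  apply: eq_integral => x _; rewrite /h.
  rewrite -(IHn (fun i => phi (lift ord0 i)) (fun i => l (lift ord0 i))
    (fun t => f (tcons (x, t))))//; last by move=> i; exact: tilt.
  rewrite -ge0_integralZl//; last 3 first.
  - apply: emeasurable_funM => //; apply/measurable_EFinP.
    apply: measurable_prod => i _.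
    by apply: measurableT_comp => //; exact: measurable_tnth.
  - by move=> t _; rewrite mule_ge0// lee_fin prodr_ge0.
  - by rewrite lee_fin.
  apply: eq_integral => t _; rewrite big_ord_recl EFinM muleA.
  by under eq_bigr do rewrite tnthS.
have mF : measurable_fun [set: T * n.-tuple T] (fun p => f (tcons
    (p.1, [tuple phi (lift ord0 i) (tnth p.2 i) | i < n]))).
  apply: (measurableT_comp mf); apply: measurableT_comp => //.
  apply/measurable_fun_pairP; split.
    exact: measurable_fst.
  exact: (measurableT_comp mapn).
rewrite tilt//.
- by apply: eq_integral => x _; apply: eq_integral => t _; rewrite mapE.
- exact: (measurable_fun_fubini_tonelli_F (m2 := iid_law P n) _ mF).
- by move=> x; exact: integral_ge0.
Qed.

Lemma ge0_integral_iid_prod n (u : 'I_n -> T -> R) :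
  (forall i, measurable_fun [set: T] (u i)) -> (forall i x, (0 <= u i x)%R) ->
  \int[iid_law P n]_s (\prod_(i < n) u i (tnth s i))%:E =
  \prod_(i < n) \int[P]_x (u i x)%:E.
Proof.
elim: n u => [|n IHn] u mu u0.
  under eq_integral do rewrite big_ord0.
  rewrite big_ord0 integral_cst// mul1e; exact: (probability_setT (iid_law P 0)).
have mprod m (w : 'I_m -> T -> R) : (forall i, measurable_fun [set: T] (w i)) ->
    measurable_fun [set: m.-tuple T] (fun s => (\prod_(i < m) w i (tnth s i))%:E).
  move=> mw; apply/measurable_EFinP; apply: measurable_prod => i _.
  by apply: measurableT_comp => //; exact: measurable_tnth.
rewrite ge0_integral_iidS//; last 2 first.
- exact: (mprod _ u).
- by move=> s; rewrite lee_fin prodr_ge0.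
rewrite big_ord_recl -IHn// -ge0_integralZr//.
- apply: eq_integral => x _.
  rewrite -ge0_integralZl//.
  + apply: eq_integral => t _; rewrite big_ord_recl EFinM.
    by under eq_bigr do rewrite tnthS.
    exact: (mprod n (fun i => u (lift ord0 i))).
  + by move=> t _; rewrite lee_fin prodr_ge0.
  + by rewrite lee_fin.
- exact/measurable_EFinP.
- by move=> x _; rewrite lee_fin.
- by apply: integral_ge0 => t _; rewrite lee_fin prodr_ge0.
Qed.

End iid.

Section sample_law.
Context {R : realType}.
Variables (F : cumulativeBounded (0%R : R) (1%R : R)) (v : {mfun R >-> R}).
Hypothesis v0 : forall x, 0 <= v x.
Local Open Scope ereal_scope.

(** Translating the j-th noise leaves [f] unchanged. This says, without conditional expectations,
    that the exponential factor has mean 1 given all design points and all other noises. *)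
Lemma noise_tilt n (j : 'I_n) (l : R) (f : n.-tuple (R * R) -> \bar R) :
  measurable_fun [set: n.-tuple (R * R)] f -> (forall s, 0 <= f s) ->
  (forall s s', (forall i, (tnth s i).1 = (tnth s' i).1) ->
    (forall i, i != j -> tnth s i = tnth s' i) -> f s = f s') ->
  \int[iid_law (pair_law F v) n]_s ((expR (l * (tnth s j).2 -
     l ^+ 2 * v (tnth s j).1 / 2))%:E * f s) =
  \int[iid_law (pair_law F v) n]_s f s.
Proof.
move=> mf f0 fj.
pose phi (i : 'I_n) (p : R * R) : R * R :=
  if i == j then (p.1, p.2 + l * v p.1)%R else p.
pose w (i : 'I_n) (p : R * R) : R :=
  if i == j then expR (l * p.2 - l ^+ 2 * v p.1 / 2) else 1%R.
have mv1 : measurable_fun [set: R * R] (fun p => v p.1).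
  exact: measurableT_comp.
transitivity (\int[iid_law (pair_law F v) n]_s
    ((\prod_(i < n) w i (tnth s i))%:E * f s)).
  apply: eq_integral => s _; congr (_%:E * _).
  rewrite (bigD1 j)//= /w eqxx big1 ?mulr1// => i ij.
  by rewrite (negbTE ij).
rewrite (@iid_tilt _ _ _ _ _ phi w)//.
- apply: eq_integral => s _; apply/esym/fj => i.
    by rewrite tnth_mktuple /phi; case: ifP.
  by rewrite tnth_mktuple /phi => /negbTE ->.
- move=> i; rewrite /phi; case: (i == j) => //.
  apply/measurable_fun_pairP; split; first exact: measurable_fst.
  apply: (@measurable_funD _ _ _ _ (fun p : R * R => p.2)).
    exact: measurable_snd.
  exact: measurable_funM.
- move=> i; rewrite /w; case: (i == j) => //.
  apply: measurableT_comp => //; apply: measurable_funB.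
    by apply: measurable_funM => //; exact: measurable_snd.
  apply: measurable_funM => //; exact: measurable_funM.
- by move=> i x; rewrite /w; case: ifP => // _; exact: expR_ge0.
- move=> i h mh h0; rewrite /w /phi; case: (i == j).
    by rewrite (pair_law_tilt F v0 (l := cst l))//.
  by apply: eq_integral => p _; rewrite mul1e.
Qed.

Lemma measurable_observations (g : R -> R) n : measurable_fun [set: R] g ->
  measurable_fun [set: n.-tuple (R * R)] (observations g (n := n)).
Proof.
move=> mg; apply/measurable_fun_tnthP => i.
rewrite (_ : _ \o _ = (fun p => (p.1, g p.1 + p.2)%R) \o (@tnth n (R * R) ^~ i)).
  apply: measurableT_comp; last exact: measurable_tnth.
  apply/measurable_fun_pairP; split; first exact: measurable_fst.
  apply: (@measurable_funD _ _ _ _ (fun p : R * R => g p.1)).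
    exact: measurableT_comp.
  exact: measurable_snd.
by apply/funext => s /=; rewrite tnth_map.
Qed.

(** The relation [l x * v x = g x] forces [g] to vanish wherever [v] does, which makes the law under
    [g] absolutely continuous with respect to the law under 0. *)
Lemma Prob_density (g l : R -> R) n (A : set (n.-tuple (R * R))) :
  measurable_fun [set: R] l -> measurable_fun [set: R] g ->
  (forall x, (l x * v x = g x)%R) -> measurable A ->
  Prob F v g A = \int[iid_law (pair_law F v) n]_s
    ((\prod_(i < n) expR (l (tnth s i).1 * (tnth s i).2 -
       l (tnth s i).1 ^+ 2 * v (tnth s i).1 / 2))%:E * (\1_A s)%:E).
Proof.
move=> ml mg lg mA.
have mv1 : measurable_fun [set: R * R] (fun p => v p.1).
  exact: measurableT_comp.
have ml1 : measurable_fun [set: R * R] (fun p => l p.1).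
  exact: measurableT_comp.
rewrite (@iid_tilt _ _ _ _ _ (fun _ p => (p.1, g p.1 + p.2)%R)
  (fun _ p => expR (l p.1 * p.2 - l p.1 ^+ 2 * v p.1 / 2)) (fun s => (\1_A s)%:E))//.
- rewrite /Prob -[in LHS](setIT (_ @^-1` _)) -integral_indic//; last first.
    by rewrite -[X in measurable X]setTI; exact: measurable_observations.
  apply: eq_integral => s _; rewrite !indicE; congr ((_ : bool)%:R%:E).
  rewrite (_ : [tuple _ | _ < _] = observations g s).
    by apply/idP/idP; rewrite !inE.
  by apply: eq_from_tnth => i; rewrite tnth_mktuple tnth_map.
- move=> _; apply/measurable_fun_pairP; split; first exact: measurable_fst.
  apply: (@measurable_funD _ _ _ _ (fun p : R * R => g p.1)).
    exact: measurableT_comp.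
  exact: measurable_snd.
- move=> _; apply: measurableT_comp => //; apply: measurable_funB.
    by apply: measurable_funM => //; exact: measurable_snd.
  apply: measurable_funM => //; apply: measurable_funM => //.
  exact: measurable_funX.
- move=> _ h mh h0; rewrite (pair_law_tilt F v0)//.
  by apply: eq_integral => p _; rewrite lg addrC.
- exact/measurable_EFinP/measurable_indic.
Qed.

Lemma unimodal_measurable (g : R -> R) : unimodal_class g ->
  measurable_fun [set: R] g.
Proof.
move=> [gl gr].
(* Clamping the argument at 0 turns each half of [g] into a function monotone on the whole line. *)
rewrite (_ : g = fun x => if (x <= 0)%R then g (Num.min x 0%R)
                          else g (Num.max x 0%R)); last first.
  apply/funext => x; case: ifPn => [x0|]; first by rewrite min_l.
  by rewrite -ltNge => x0; rewrite max_l// ltW.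
apply: measurable_fun_ifT.
- exact: (measurable_fun_ler (f := id) (g := cst 0%R)).
- apply: nondecreasing_measurable => // x y xy; apply: gl.
    by rewrite le_min !ge_min xy/= lexx orbT.
  by rewrite ge_min lexx orbT.
- apply: nonincreasing_measurable => // x y xy; apply: gr.
    by rewrite le_max lexx orbT.
  by rewrite ge_max !le_max xy/= lexx orbT.
Qed.

End sample_law.

(** * Nearest neighbours *)

Section nearest_neighbors.
Context {R : realType}.

Definition ncount n (s : n.-tuple (R * R)) (t : R) : nat :=
  #|[set i | `|(tnth s i).1| < t]%SET|.

Lemma ncount_le n (s : n.-tuple (R * R)) t : (ncount s t <= n)%N.
Proof. by rewrite -[X in (_ <= X)%N](card_ord n) max_card. Qed.

(** Trades the sorted list for a count of indices, which is easy to measure and to bound in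
    probability. *)
Lemma absX_order_lt n (s : n.-tuple (R * R)) t k : (0 < k <= n)%N ->
  (absX_order s k < t) = (k <= ncount s t)%N.
Proof.
move=> /andP[k0 kn]; rewrite /absX_order /ncount.
set r := [seq _ | i <- _].
have -> : #|[set i | `|(tnth s i).1| < t]%SET| = count (< t) (sort <=%R r).
  rewrite cardE /enum_mem size_filter count_sort count_map enumT.
  by apply: eq_count => i /=; rewrite inE.
have sr : size (sort <=%R r) = n by rewrite size_sort size_map size_enum_ord.
have sorted_r : sorted <=%O (sort <=%R r) by apply: sort_sorted; exact: le_total.
have [kc|] := leqP k (count (< t) (sort <=%R r)).
  by apply: nth_count_lt => //; rewrite prednK.
move=> kc; apply/negbTE; rewrite -leNgt.
by apply: nth_count_ge; rewrite // sr -ltnS prednK// kc.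
Qed.

Lemma kbarE n (s : n.-tuple (R * R)) eta : kbar s eta = ncount s eta.
Proof.
rewrite /kbar; apply/eqP; rewrite eqn_leq; apply/andP; split.
  rewrite big_nat_cond; apply/bigmax_leqP_seq => k _.
  by rewrite andbC ltnS => /andP[+ kn]; rewrite absX_order_lt.
have [->//|c0] := posnP (ncount s eta).
apply: (leq_bigmax_seq (r := index_iota 1 n.+1) (F := id)).
  by rewrite mem_index_iota ltnS c0 ncount_le.
by rewrite absX_order_lt ?c0 ?ncount_le.
Qed.

Section rank.
Variables (n : nat) (s : n.-tuple (R * R)).
Implicit Types i j : 'I_n.
Let absX i : R := `|(tnth s i).1|.
Let lexlt i j := (absX i < absX j) || ((absX i == absX j) && (i <= j)%N).

Let lexlt_trans j i k : lexlt i j -> lexlt j k -> lexlt i k.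
Proof.
rewrite /lexlt => /orP[ij|/andP[/eqP -> ij]] /orP[jk|/andP[/eqP jk jk']].
- by rewrite (lt_trans ij jk).
- by rewrite -jk ij.
- by rewrite jk.
- by rewrite jk eqxx (leq_trans ij jk') orbT.
Qed.

Let lexlt_total i j : lexlt i j || lexlt j i.
Proof.
rewrite /lexlt; case: (ltgtP (absX i) (absX j)) => //= _.
exact: leq_total.
Qed.

Let lexlt_anti i j : lexlt i j -> lexlt j i -> i = j.
Proof.
rewrite /lexlt; case: (ltgtP (absX i) (absX j)) => //= _ ij ji.
by apply/val_inj/anti_leq; rewrite ij ji.
Qed.

Lemma absX_rankE j : absX_rank s j =
  #|[set i | (`|(tnth s i).1| < `|(tnth s j).1|) ||
    ((`|(tnth s i).1| == `|(tnth s j).1|) && (i <= j)%N)]%SET|.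
Proof.
by rewrite /absX_rank; apply: eq_card => i; apply/idP/idP; rewrite !inE.
Qed.

Let lexlt_refl j : lexlt j j.
Proof. by rewrite /lexlt eqxx leqnn orbT. Qed.

Lemma absX_rank_gt0 j : (0 < absX_rank s j)%N.
Proof.
rewrite absX_rankE; apply/card_gt0P; exists j; rewrite inE; exact: lexlt_refl.
Qed.

Lemma absX_rank_le j : (absX_rank s j <= n)%N.
Proof. by rewrite -[X in (_ <= X)%N](card_ord n) max_card. Qed.

(** A rank is the size of an initial segment of a total order. If [i] precedes [j] their segments
    are nested, so equal sizes make them equal and put [j] before [i]. *)
Lemma absX_rank_inj : injective (absX_rank s).
Proof.
move=> i j; wlog ij : i j / lexlt i j => [h|].
  by case/orP: (lexlt_total i j) => ?; [exact: h|move=> ?; apply/esym/h].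
rewrite !absX_rankE => ijE.
have sub : [set i0 | lexlt i0 i]%SET \subset [set i0 | lexlt i0 j]%SET.
  by apply/fintype.subsetP => k; rewrite !inE => /lexlt_trans; exact.
apply: lexlt_anti => //.
have := lexlt_refl j.
by have := subset_cardP ijE sub j; rewrite !inE -/(lexlt _ _) -/(lexlt _ _) => ->.
Qed.

Let rank_ord j : 'I_n := Ordinal (eq_ind_r
  (fun m => (m <= n)%N) (absX_rank_le j) (prednK (absX_rank_gt0 j))).

Lemma absX_rank_surj k : (0 < k <= n)%N -> exists j, absX_rank s j = k.
Proof.
move=> /andP[k0 kn].
have rank_inj : injective rank_ord.
  move=> i j /(congr1 val)/= ij; apply: absX_rank_inj.
  by rewrite -(prednK (absX_rank_gt0 i)) ij prednK// absX_rank_gt0.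
have kn' : (k.-1 < n)%N by rewrite prednK.
have [f rK fK] := injF_bij rank_inj.
exists (f (Ordinal kn')); have /(congr1 val)/= := fK (Ordinal kn').
by move=> /(congr1 succn); rewrite !prednK// absX_rank_gt0.
Qed.

Lemma card_absX_rank_le k : (k <= n)%N ->
  #|[set j | (absX_rank s j <= k)%N]%SET| = k.
Proof.
elim: k => [_|k IHk kn].
  apply/eqP; rewrite cards_eq0; apply/eqP/setP => j; rewrite !inE leqn0.
  by rewrite gtn_eqF ?absX_rank_gt0.
have [j jk] := absX_rank_surj (k := k.+1) kn.
rewrite (_ : [set j | _]%SET = j |: [set j | (absX_rank s j <= k)%N])%SET.
  by rewrite cardsU1 inE jk ltnn/= IHk// ltnW.
apply/setP => i; rewrite !inE leq_eqVlt -jk (inj_eq absX_rank_inj).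
by rewrite jk ltnS.
Qed.

(** If [j] lay at distance at least [t], all the points closer than [t] would precede it, and [j]
    itself would make its rank exceed [ncount s t]. *)
Lemma absX_rank_ncount j t k : (absX_rank s j <= k <= ncount s t)%N ->
  `|(tnth s j).1| < t.
Proof.
move=> /andP[jk kt]; rewrite ltNge; apply/negP => tj.
suff : (ncount s t < absX_rank s j)%N by rewrite ltnNge (leq_trans jk kt).
rewrite absX_rankE; apply: proper_card; apply/properP; split.
  apply/fintype.subsetP => i; rewrite !inE => it.
  by rewrite /lexlt (lt_le_trans it tj).
exists j; rewrite !inE; [exact: lexlt_refl|by rewrite -leNgt].
Qed.

End rank.

Lemma eq_absX_rank n (s s' : n.-tuple (R * R)) :
  (forall i, (tnth s i).1 = (tnth s' i).1) -> absX_rank s =1 absX_rank s'.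
Proof. by move=> ss' j; rewrite /absX_rank ss'; under eq_fun do rewrite ss'. Qed.

Lemma eq_ncount n (s s' : n.-tuple (R * R)) t :
  (forall i, (tnth s i).1 = (tnth s' i).1) -> ncount s t = ncount s' t.
Proof. by move=> ss'; apply: eq_card => i; rewrite !inE !ss'. Qed.

End nearest_neighbors.

(** * Ville's inequality for the ranked noise *)

Section measurable_bool.
Context d (T : measurableType d).

Lemma measurable_boolset (b : T -> bool) :
  measurable_fun [set: T] b -> measurable [set x | b x].
Proof.
move=> mb; rewrite (_ : [set x | b x] = setT `&` b @^-1` [set true]).
  exact: mb.
by rewrite setTI.
Qed.

(** The cardinal is read as a real sum of indicators. *)
Lemma measurable_card_ge (R : realType) (I : finType) (b : I -> T -> bool) k :
  (forall i, measurable_fun [set: T] (b i)) ->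
  measurable_fun [set: T] (fun x => (k <= #|[set i | b i x]%SET|)%N).
Proof.
move=> mb; rewrite (_ : (fun x => _) =
  (fun x => (k%:R : R) <= \sum_(i : I) (if b i x then 1 else 0))).
  apply: measurable_fun_ler => //; apply: measurable_sum => i.
  exact: measurable_fun_ifT.
apply/funext => x; rewrite -big_mkcond/= sumr_const ler_nat; congr (_ <= _)%N.
by apply: eq_card => i; rewrite inE.
Qed.

Lemma ge0_markov (R : realType) (mu : {measure set T -> \bar R}) (f : T -> R) (b : R) :
  0 <= b -> measurable_fun [set: T] f -> (forall x, 0 <= f x) ->
  (b%:E * mu [set x | (b <= f x)%R] <= \int[mu]_x (f x)%:E)%E.
Proof.
move=> b0 mf f0.
have mbf : measurable [set x | b <= f x].
  by apply: measurable_boolset; exact: measurable_fun_ler.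
rewrite -integral_cst//=.
apply: (@le_trans _ _ (\int[mu]_(x in [set x | (b <= f x)%R]) (f x)%:E)%E).
  apply: ge0_le_integral => //.
  by apply: measurable_funTS; exact/measurable_EFinP.
apply: ge0_subset_integral => //; first exact/measurable_EFinP.
by move=> x _; rewrite lee_fin.
Qed.

End measurable_bool.

Section measurable_neighbors.
Context {R : realType} (n : nat).
Notation sample := (n.-tuple (R * R)).

Lemma measurable_absX (i : 'I_n) :
  measurable_fun [set: sample] (fun s => `|(tnth s i).1|).
Proof.
apply: measurableT_comp => //; apply: (@measurableT_comp _ _ _ _ _ _ fst) => //.
exact: measurable_tnth.
Qed.

Lemma measurable_noise (i : 'I_n) :
  measurable_fun [set: sample] (fun s => (tnth s i).2).
Proof.
apply: (@measurableT_comp _ _ _ _ _ _ snd) => //; exact: measurable_tnth.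
Qed.

Lemma measurable_ncount_ge t k :
  measurable_fun [set: sample] (fun s => (k <= ncount s t)%N).
Proof.
apply: (measurable_card_ge R) => i; apply: measurable_fun_ltr => //.
exact: measurable_absX.
Qed.

Lemma measurable_absX_rank_ge (j : 'I_n) k :
  measurable_fun [set: sample] (fun s => (k <= absX_rank s j)%N).
Proof.
under eq_fun do rewrite absX_rankE.
apply: (measurable_card_ge R) => i; apply: measurable_or.
  by apply: measurable_fun_ltr => //; exact: measurable_absX.
apply: measurable_and => //.
by apply: measurable_fun_eqr; exact: measurable_absX.
Qed.

Lemma measurable_absX_rank_le (j : 'I_n) k :
  measurable_fun [set: sample] (fun s => (absX_rank s j <= k)%N).
Proof.
under eq_fun do rewrite leqNgt.
apply: measurable_neg; exact: measurable_absX_rank_ge.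
Qed.

Lemma measurable_absX_rank_eq (j : 'I_n) k :
  measurable_fun [set: sample] (fun s => absX_rank s j == k).
Proof.
under eq_fun do rewrite eqn_leq.
by apply: measurable_and; [exact: measurable_absX_rank_le|
  exact: measurable_absX_rank_ge].
Qed.

(** The second components are the errors in the underlying sample and the responses in the observed
    one, so the same sum is both the noise walk and the numerator of [ghat]. *)
Definition noise_sum (s : sample) k : R :=
  \sum_(j < n | (absX_rank s j <= k)%N) (tnth s j).2.

Lemma measurable_noise_sum k :
  measurable_fun [set: sample] (fun s => noise_sum s k).
Proof.
rewrite /noise_sum; under eq_fun do rewrite big_mkcond.
apply: measurable_sum => j; apply: measurable_fun_ifT => //.
- exact: measurable_absX_rank_le.
- exact: measurable_noise.
Qed.

Lemma ghatE eta k (s : sample) : (0 < k <= n)%N ->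
  ghat s eta k = if (k <= ncount s eta)%N then noise_sum s k / k%:R else 0.
Proof. by move=> kn; rewrite /ghat absX_order_lt. Qed.

Lemma measurable_ghat eta k : (0 < k <= n)%N ->
  measurable_fun [set: sample] (fun s => ghat s eta k).
Proof.
move=> kn; under eq_fun do rewrite ghatE//.
apply: measurable_fun_ifT => //; first exact: measurable_ncount_ge.
by apply: measurable_funM => //; exact: measurable_noise_sum.
Qed.

End measurable_neighbors.

Section ville.
Context {R : realType}.
Variables (F : cumulativeBounded (0%R : R) (1%R : R)) (v : {mfun R >-> R}).
Hypothesis v0 : forall x, 0 <= v x.
Variables (n : nat) (l b : R).
Notation sample := (n.-tuple (R * R)).
Notation mu := (iid_law (pair_law F v) n).

Definition tilt (s : sample) (j : 'I_n) : R :=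
  expR (l * (tnth s j).2 - l ^+ 2 * v (tnth s j).1 / 2).

Definition tilt_martingale (s : sample) k : R :=
  \prod_(j < n | (absX_rank s j <= k)%N) tilt s j.

(** [tilt_martingale] frozen once it reaches [b]. Freezing turns a crossing at any rank into an
    event about the value at rank [n], to which Markov's inequality applies. For a rank between 1
    and [n] the product has exactly one factor. *)
Fixpoint stopped_martingale (s : sample) k : R :=
  if k is k'.+1 then
    let m := stopped_martingale s k' in
    if b <= m then m else m * \prod_(j < n | absX_rank s j == k) tilt s j
  else 1.

Lemma stopped_martingale_ge0 s k : 0 <= stopped_martingale s k.
Proof.
elim: k => [|k IHk] //=; case: ifP => // _.
by rewrite mulr_ge0 ?prodr_ge0// => j _; exact: expR_ge0.
Qed.

Lemma measurable_tilt j : measurable_fun [set: sample] (fun s => tilt s j).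
Proof.
have mv : measurable_fun [set: sample] (fun s => v (tnth s j).1).
  apply: (@measurableT_comp _ _ _ _ _ _ v) => //.
  by apply: (@measurableT_comp _ _ _ _ _ _ fst) => //; exact: measurable_tnth.
apply: measurableT_comp => //; apply: measurable_funB.
  by apply: measurable_funM => //; exact: measurable_noise.
by apply: measurable_funM => //; exact: measurable_funM.
Qed.

Lemma measurable_stopped_martingale k :
  measurable_fun [set: sample] (fun s => stopped_martingale s k).
Proof.
elim: k => [|k IHk] //=; apply: measurable_fun_ifT => //.
  exact: measurable_fun_ler.
apply: measurable_funM => //; under eq_fun do rewrite big_mkcond.
apply: measurable_prod => j _; apply: measurable_fun_ifT => //.
  exact: measurable_absX_rank_eq.
exact: measurable_tilt.
Qed.

(** Below [b] nothing has been frozen yet, so the two processes still agree there. *)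
Lemma stopped_martingale_cross s k :
  b <= tilt_martingale s k -> b <= stopped_martingale s k.
Proof.
suff H m : (stopped_martingale s m < b ->
    stopped_martingale s m = tilt_martingale s m).
  by move=> bM; rewrite leNgt; apply/negP => sb; move: (sb); rewrite H// ltNge bM.
rewrite /tilt_martingale; elim: m => [|m IHm] /=.
  by rewrite big1// => j; rewrite leqn0 gtn_eqF// absX_rank_gt0.
case: ifPn => [bm mb|]; first by move: bm; rewrite leNgt mb.
rewrite -ltNge => /IHm -> _.
rewrite [RHS](bigID (fun j => absX_rank s j == m.+1))/= mulrC; congr (_ * _).
  by apply: eq_bigl => j; rewrite andb_idl// => /eqP ->.
by apply: eq_bigl => j; rewrite -ltnS ltn_neqAle andbC.
Qed.

Lemma stopped_martingale_mono s k m : (k <= m)%N ->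
  b <= stopped_martingale s k -> b <= stopped_martingale s m.
Proof.
elim: m => [|m IHm]; first by rewrite leqn0 => /eqP ->.
rewrite leq_eqVlt => /predU1P[->//|km bk] /=.
by have bm := IHm km bk; rewrite bm.
Qed.

(** Adaptedness: given the design, the value at rank [k] depends only on the noises of the [k]
    nearest neighbours. *)
Lemma eq_stopped_martingale s s' k :
  (forall i, (tnth s i).1 = (tnth s' i).1) ->
  (forall i, (absX_rank s i <= k)%N -> tnth s i = tnth s' i) ->
  stopped_martingale s k = stopped_martingale s' k.
Proof.
move=> ss'; elim: k => [//|k IHk] eqk /=.
rewrite IHk; last by move=> i ik; apply: eqk; rewrite leqW.
case: ifP => // _; congr (_ * _).
under eq_bigl do rewrite (eq_absX_rank ss').
apply: eq_bigr => i; rewrite -(eq_absX_rank ss') => /eqP ik.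
by rewrite /tilt eqk// ik.
Qed.

Local Open Scope ereal_scope.

(** Which observation is the next neighbour is random, so the integral is split by the index [j] of
    rank [k.+1]. [A j] is the part already frozen and [B j] the part still running; by adaptedness
    [B j] does not involve the noise of [j], and [noise_tilt] removes the new factor. *)
Lemma stopped_martingale_step k : (k < n)%N ->
  \int[mu]_s (stopped_martingale s k.+1)%:E =
  \int[mu]_s (stopped_martingale s k)%:E.
Proof.
move=> kn.
pose A (j : 'I_n) s : R := if absX_rank s j == k.+1 then
  if (b <= stopped_martingale s k)%R then stopped_martingale s k else 0%R else 0%R.
pose B (j : 'I_n) s : R := if absX_rank s j == k.+1 then
  if (b <= stopped_martingale s k)%R then 0%R else stopped_martingale s k else 0%R.
have A0 j s : 0 <= (A j s)%:E.
  rewrite lee_fin /A; case: ifP => // _; case: ifP => // _.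
  exact: stopped_martingale_ge0.
have B0 j s : 0 <= (B j s)%:E.
  rewrite lee_fin /B; case: ifP => // _; case: ifP => // _.
  exact: stopped_martingale_ge0.
have mm := measurable_stopped_martingale k.
have mb : measurable_fun [set: sample] (fun s => b <= stopped_martingale s k)%R.
  exact: measurable_fun_ler.
have mA j : measurable_fun [set: sample] (fun s => (A j s)%:E).
  apply/measurable_EFinP; apply: measurable_fun_ifT => //.
    exact: measurable_absX_rank_eq.
  exact: measurable_fun_ifT.
have mB j : measurable_fun [set: sample] (fun s => (B j s)%:E).
  apply/measurable_EFinP; apply: measurable_fun_ifT => //.
    exact: measurable_absX_rank_eq.
  exact: measurable_fun_ifT.
have mtilt j : measurable_fun [set: sample] (fun s => (tilt s j)%:E).
  by apply/measurable_EFinP; exact: measurable_tilt.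
(* Taking [w] to be [tilt] gives the value at rank [k.+1], and taking [w] to be 1 gives the value at
   rank [k]. *)
have sumA (w : sample -> 'I_n -> R) s :
    (stopped_martingale s k *
      (if b <= stopped_martingale s k then 1
       else \prod_(j < n | absX_rank s j == k.+1) w s j))%R%:E =
    \sum_(j < n) ((A j s)%:E + (w s j)%:E * (B j s)%:E).
  have [j jk] : exists j, absX_rank s j = k.+1 by exact: absX_rank_surj.
  have jE i : (absX_rank s i == k.+1) = (i == j).
    by rewrite -jk (inj_eq (@absX_rank_inj _ _ s)).
  rewrite [RHS](bigD1 j)//= [X in _ = _ + X]big1 ?addr0; last first.
    by move=> i /negbTE ij; rewrite /A /B jE ij mule0 adde0.
  rewrite /A /B jE eqxx (eq_bigl _ _ jE) big_pred1_eq.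
  by case: ifP => _; rewrite ?mule0 ?adde0 ?mulr1// add0e -EFinM mulrC.
transitivity (\int[mu]_s \sum_(j < n) ((A j s)%:E + (tilt s j)%:E * (B j s)%:E)).
  apply: eq_integral => s _; rewrite -(sumA tilt) /=; congr EFin.
  by case: ifP => // _; rewrite mulr1.
transitivity (\int[mu]_s \sum_(j < n) ((A j s)%:E + (B j s)%:E)); last first.
  apply: eq_integral => s _.
  under eq_bigr do rewrite -[X in _ + X]mul1e.
  rewrite -(sumA (fun _ _ => 1%R)); congr EFin.
  by rewrite big1// if_same mulr1.
rewrite !ge0_integral_sum//; last 4 first.
- by move=> j; exact: emeasurable_funD.
- by move=> j s _; exact: adde_ge0.
- by move=> j; apply: emeasurable_funD => //; exact: emeasurable_funM.
- move=> j s _; apply: adde_ge0 => //; apply: mule_ge0 => //.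
  by rewrite lee_fin expR_ge0.
apply: eq_bigr => j _; rewrite !ge0_integralD//; last 2 first.
- by move=> s _; apply: mule_ge0 => //; rewrite lee_fin expR_ge0.
- exact: emeasurable_funM.
congr (_ + _); apply: noise_tilt => // s s' ss' sj; congr EFin.
rewrite /B (eq_absX_rank ss'); case: ifPn => // /eqP jk.
rewrite (@eq_stopped_martingale s s')// => i ik; apply: sj.
by apply: contraTneq ik => ->; rewrite (eq_absX_rank ss') jk ltnn.
Qed.

Lemma ville_inequality : (0 < b)%R ->
  mu [set s | (b <= stopped_martingale s n)%R] <= (b^-1)%:E.
Proof.
move=> b0; rewrite -(@lee_pmul2l _ b%:E)//.
rewrite -EFinM mulfV ?gt_eqF//.
apply: le_trans (ge0_markov _ (ltW b0) (measurable_stopped_martingale n)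
  (stopped_martingale_ge0^~ n)) _.
suff E k : (k <= n)%N -> \int[mu]_s (stopped_martingale s k)%:E = 1.
  by rewrite E.
elim: k => [_|k IHk kn]; last by rewrite stopped_martingale_step// IHk// ltnW.
by rewrite /= integral_cst// mul1e; exact: (probability_setT mu).
Qed.

End ville.

Section deviation.
Context {R : realType}.
Variables (F : cumulativeBounded (0%R : R) (1%R : R)) (v : {mfun R >-> R}).
Hypothesis v0 : forall x, 0 <= v x.
Variable eta : R.
Hypothesis eta0 : 0 < eta.
Hypothesis v_le : forall x, `|x| < eta -> v x <= eta^-1.

(** Ranks are limited to neighbours within [eta], where the variance is at most [eta^-1]. The factor
    [c] is a sign: 1 serves the critical value, -1 the downward deviations of the estimator. *)
Definition noise_exceeds n m (c a : R) : set (n.-tuple (R * R)) :=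
  [set s | exists k, [/\ (0 < k <= m)%N, (k <= ncount s eta)%N &
                        a <= c * noise_sum s k]].

Lemma measurable_noise_exceeds n m c a : measurable (@noise_exceeds n m c a).
Proof.
rewrite (_ : noise_exceeds m c a = \bigcup_k [set s : n.-tuple (R * R) |
    [&& (0 < k <= m)%N, (k <= ncount s eta)%N & a <= c * noise_sum s k]]).
  apply: bigcup_measurable => k _; apply: measurable_boolset.
  apply: measurable_and => //; apply: measurable_and.
    exact: measurable_ncount_ge.
  apply: measurable_fun_ler => //; apply: measurable_funM => //.
  exact: measurable_noise_sum.
apply/seteqP; split => s /= [k]; first by move=> [h1 h2 h3]; exists k => //; apply/and3P.
by move=> _ /and3P h; exists k.
Qed.

Lemma noise_deviation n m (c a : R) : (0 < m)%N -> c ^+ 2 = 1 -> 0 <= a ->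
  (iid_law (pair_law F v) n (noise_exceeds m c a) <=
   (expR (- (a ^+ 2 * eta / (2 * m%:R))))%:E)%E.
Proof.
move=> m0 c1 a0.
have mR : 0 < m%:R :> R by rewrite ltr0n.
(* Up to the sign [c], this slope maximizes l a - l^2 m / (2 eta), the exponent left once the total
   variance is bounded by m / eta; the maximum a^2 eta / (2 m) is the logarithm of [b]. *)
pose l := c * (a * eta / m%:R).
pose b := expR (a ^+ 2 * eta / (2 * m%:R)).
rewrite expRN; apply: le_trans (ville_inequality F v0 n l (expR_gt0 _)).
apply: le_measure; rewrite ?inE.
- exact: measurable_noise_exceeds.
- apply: measurable_boolset; apply: measurable_fun_ler => //.
  exact: measurable_stopped_martingale.
move=> s [k [/andP[k0 km] kc aS]] /=.
have kn : (k <= n)%N := leq_trans kc (ncount_le s eta).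
apply: (stopped_martingale_mono kn); apply: stopped_martingale_cross.
rewrite /tilt_martingale /tilt -expR_sum ler_expR sumrB -mulr_sumr -/(noise_sum s k).
have lS : a ^+ 2 * eta / m%:R <= l * noise_sum s k.
  rewrite (_ : _ / _ = a * eta / m%:R * a); last by ring.
  rewrite (_ : l * _ = a * eta / m%:R * (c * noise_sum s k)); last by rewrite /l; ring.
  by rewrite ler_wpM2l// divr_ge0// ?mulr_ge0// ltW.
have V : \sum_(j < n | (absX_rank s j <= k)%N) v (tnth s j).1 <= m%:R / eta.
  apply: (@le_trans _ _ (\sum_(j < n | (absX_rank s j <= k)%N) eta^-1)).
    apply: ler_sum => j jk; apply: v_le.
    by apply: (absX_rank_ncount (k := k)); rewrite jk.
  rewrite sumr_const -cardsE card_absX_rank_le// -[leLHS]mulr_natr mulrC.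
  by rewrite ler_wpM2r ?ler_nat// invr_ge0 ltW.
under [X in _ <= _ - X]eq_bigr do rewrite -mulrA mulrC -mulrA.
rewrite -mulr_suml.
have lV : (\sum_(j < n | (absX_rank s j <= k)%N) v (tnth s j).1) * (2^-1 * l ^+ 2)
    <= a ^+ 2 * eta / (2 * m%:R).
  apply: (@le_trans _ _ (m%:R / eta * (2^-1 * l ^+ 2))).
    by rewrite ler_wpM2r// mulr_ge0// sqr_ge0.
  rewrite /l exprMn c1 le_eqVlt; apply/predU1P; left; field.
  by rewrite !gt_eqF.
have -> : a ^+ 2 * eta / (2 * m%:R) =
    a ^+ 2 * eta / m%:R - a ^+ 2 * eta / (2 * m%:R).
  by field; rewrite gt_eqF.
by rewrite lerB.
Qed.

End deviation.

(** * The critical value *)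

Section quantile.
Context d (T : measurableType d) (R : realType) (P : probability T R).
Variables (X : {RV P >-> R}) (p : R).
Hypothesis p01 : 0 < p < 1.
Let S := [set t : R | (p%:E <= cdf X t)%E].

Let S_lbound : has_lbound S.
Proof.
have /andP[p0 _] := p01.
have := cvg_cdfNy0 X => /(_ [set y | (y < p%:E)%E]).
have nb : nbhs (0 : \bar R) [set y | (y < p%:E)%E].
  by apply: open_nbhs_nbhs; split; [exact: open_ereal_lt_ereal|rewrite /= lte_fin].
move=> /(_ nb)[M [_ hM]]; exists (M - 1) => // t St.
rewrite leNgt; apply/negP => tM.
have := hM t; rewrite /= => /(_ (lt_trans tM _)); rewrite ltrBlDr ltrDl ltr01 => /(_ isT).
by rewrite ltNge St.
Qed.

Let S_nonempty : S !=set0.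
Proof.
have /andP[_ p1] := p01.
have := cvg_cdfy1 X => /(_ [set y | (p%:E < y)%E]).
have nb : nbhs (1 : \bar R)%E [set y | (p%:E < y)%E].
  by apply: open_nbhs_nbhs; split; [exact: open_ereal_gt_ereal|rewrite /= lte_fin].
move=> /(_ nb)[M [_ hM]]; exists (M + 1).
by apply/ltW/hM; rewrite ltrDl.
Qed.

Lemma quantile_le t : (p%:E <= cdf X t)%E -> inf S <= t.
Proof. by move=> pt; exact: ge_inf. Qed.

(** If the infimum were not attained, right continuity would keep the distribution function below
    [p] just to the right of [inf S], where elements of [S] must lie. *)
Lemma quantile_cdf : (p%:E <= cdf X (inf S))%E.
Proof.
rewrite leNgt; apply/negP => qp.
have rc : cdf X x @[x --> (inf S)^'+] --> cdf X (inf S) := @cdf_right_continuous _ _ _ _ X _.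
have nb : nbhs (cdf X (inf S)) [set y | (y < p%:E)%E].
  by apply: open_nbhs_nbhs; split => //; exact: open_ereal_lt_ereal.
have [e /= e0 he] := rc _ nb.
have hi : has_inf S by split.
have [t St te] := inf_adherent e0 hi.
have it : inf S <= t by apply: ge_inf => //; case: hi.
have ne : inf S < t.
  rewrite lt_neqAle it andbT; apply/eqP => itE.
  by move: qp; rewrite itE ltNge => /negP; exact.
have ball_t : `|inf S - t| < e by rewrite distrC ger0_norm ?subr_ge0// ltrBlDl.
by have := he t ball_t ne; rewrite /= ltNge => /negP; exact.
Qed.

End quantile.

Lemma bigmaxe_leP (R : realType) (I : eqType) (r : seq I) (f : I -> \bar R) t :
  (\big[maxe/-oo]_(i <- r) f i <= t)%E <-> (forall i, i \in r -> (f i <= t)%E).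
Proof.
elim: r => [|i r IHr]; first by rewrite big_nil leNye.
rewrite big_cons ge_max; split => [/andP[it /IHr rt] k|rt].
  by rewrite inE => /predU1P[->//|]; exact: rt.
apply/andP; split; first by apply: rt; rewrite mem_head.
by apply/IHr => k kr; apply: rt; rewrite inE kr orbT.
Qed.

Section max_statistic.
Context {R : realType}.
Variables (eta : R) (n : nat).
Notation sample := (n.-tuple (R * R)).

(** The default value is the term [k = 1], so for [n > 0] this real maximum agrees with the extended
    one, which starts from [-oo], in [crit_value]. *)
Definition max_stat (s : sample) : R :=
  \big[Num.max/ghat s eta 1]_(1 <= k < n.+1) (Num.sqrt k%:R * ghat s eta k).

Lemma measurable_max_stat : (0 < n)%N -> measurable_fun [set: sample] max_stat.
Proof.
move=> n0; rewrite /max_stat.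
have : all (fun k => 0 < k <= n)%N (index_iota 1 n.+1).
  by apply/allP => k; rewrite mem_index_iota ltnS.
elim: (index_iota 1 n.+1) => [_|k r IHr /andP[kn rn]].
  by under eq_fun do rewrite big_nil; exact: measurable_ghat.
under eq_fun do rewrite big_cons.
apply: measurable_maxr; last exact: IHr.
by apply: measurable_funM => //; exact: measurable_ghat.
Qed.

Lemma max_stat_leP (s : sample) t : (0 < n)%N ->
  (max_stat s <= t <-> forall k, (0 < k <= n)%N -> Num.sqrt k%:R * ghat s eta k <= t).
Proof.
move=> n0; rewrite /max_stat.
have g1 : ghat s eta 1 = Num.sqrt 1%:R * ghat s eta 1 by rewrite sqrtr1 mul1r.
suff H (r : seq nat) : \big[Num.max/ghat s eta 1]_(k <- r)
    (Num.sqrt k%:R * ghat s eta k) <= t <-> ghat s eta 1 <= t /\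
    forall k, k \in r -> Num.sqrt k%:R * ghat s eta k <= t.
  rewrite H; split => [[_ rt] k kn|rt]; first by apply: rt; rewrite mem_index_iota ltnS.
  split; first by rewrite g1; exact: rt.
  by move=> k; rewrite mem_index_iota ltnS; exact: rt.
elim: r => [|k r IHr]; first by rewrite big_nil; split => // -[].
rewrite big_cons ge_max; split => [/andP[kt /IHr[t1 rt]]|[t1 rt]].
  by split => // i; rewrite inE => /predU1P[->//|]; exact: rt.
apply/andP; split; first by apply: rt; rewrite mem_head.
by apply/IHr; split => // i ir; apply: rt; rewrite inE ir orbT.
Qed.

Lemma max_stat_leE (s : sample) t : (0 < n)%N ->
  (\big[maxe/-oo]_(1 <= k < n.+1) (Num.sqrt k%:R * ghat s eta k)%:E <= t%:E)%E
  = (max_stat s <= t).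
Proof.
move=> n0; apply/idP/idP => [/bigmaxe_leP h|/max_stat_leP h].
  apply/max_stat_leP => // k kn.
  by rewrite -lee_fin; apply: h; rewrite mem_index_iota ltnS.
by apply/bigmaxe_leP => k; rewrite mem_index_iota ltnS lee_fin; exact: h.
Qed.

End max_statistic.

Section critical_value.
Context {R : realType}.
Variables (F : cumulativeBounded (0%R : R) (1%R : R)) (v : {mfun R >-> R}).
Variables (eta alpha : R).
Hypothesis alpha01 : 0 < alpha < 1.
Variable n : nat.
Hypothesis n0 : (0 < n)%N.
Notation sample := (n.-tuple (R * R)).
Notation mu := (iid_law (pair_law F v) n).

Lemma observations0 (s : sample) : observations (fun=> 0) s = s.
Proof.
by apply: eq_from_tnth => i; rewrite tnth_map add0r; case: (tnth s i).
Qed.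

Let X : {RV mu >-> R} := HB.pack (@max_stat R eta n)
  (isMeasurableFun.Build _ _ _ _ _ (measurable_max_stat eta n0)).

Let crit_set : crit_value eta F v alpha n =
  inf [set t : R | ((1 - alpha)%:E <= cdf X t)%E].
Proof.
congr inf; apply/funext => t; congr (is_true (_ <= _)%E).
rewrite /Prob /cdf /distribution /pushforward; congr (mu _).
by apply/funext => s; rewrite /= observations0 max_stat_leE// in_itv.
Qed.

Let p01 : 0 < 1 - alpha < 1.
Proof. by move/andP : alpha01 => [? ?]; rewrite subr_gt0 ltrBlDr ltrDl; apply/andP. Qed.

Lemma crit_value_le t :
  ((1 - alpha)%:E <= mu [set s : sample | (max_stat eta s <= t)%R])%E ->
  crit_value eta F v alpha n <= t.
Proof. by move=> h; rewrite crit_set; apply: quantile_le. Qed.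

Lemma crit_value_coverage :
  ((1 - alpha)%:E <= mu [set s : sample |
    (max_stat eta s <= crit_value eta F v alpha n)%R])%E.
Proof. by rewrite crit_set; exact: (quantile_cdf X p01). Qed.

End critical_value.

(** * Coverage of the adaptive interval *)

Section observed.
Context {R : realType}.
Variables (g : R -> R) (n : nat) (s : n.-tuple (R * R)).

Lemma observations_fst i : (tnth (observations g s) i).1 = (tnth s i).1.
Proof. by rewrite tnth_map. Qed.

Lemma ncount_observations t : ncount (observations g s) t = ncount s t.
Proof. by apply: eq_ncount => i; rewrite observations_fst. Qed.

Lemma absX_rank_observations j : absX_rank (observations g s) j = absX_rank s j.
Proof. by apply: eq_absX_rank => i; rewrite observations_fst. Qed.

Lemma ghat_observations eta k : (0 < k <= ncount s eta)%N ->
  ghat (observations g s) eta k =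
  (\sum_(j < n | (absX_rank s j <= k)%N) g (tnth s j).1 + noise_sum s k) / k%:R.
Proof.
move=> /andP[k0 kc]; have kn := leq_trans kc (ncount_le s eta).
rewrite ghatE ?k0// ncount_observations kc; congr (_ / _).
rewrite /noise_sum -big_split/=.
under eq_bigl do rewrite absX_rank_observations.
by apply: eq_bigr => j _; rewrite tnth_map.
Qed.

Lemma sum_rank_const k (y : R) : (k <= n)%N ->
  \sum_(j < n | (absX_rank s j <= k)%N) y = k%:R * y.
Proof. by move=> kn; rewrite sumr_const -cardsE card_absX_rank_le// mulr_natl. Qed.

End observed.

Section star_interval.
Context {R : realType}.
Variables (F : cumulativeBounded (0%R : R) (1%R : R)) (v : {mfun R >-> R}).
Variables (eta alpha : R) (n : nat).
Notation sample := (n.-tuple (R * R)).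
Notation mu := (iid_law (pair_law F v) n).
Notation crit := (crit_value eta F v alpha n).

Lemma chat_star_leP (s : sample) y :
  (chat_star eta F v alpha s <= y%:E)%E <->
  (forall k, (0 < k <= ncount s eta)%N -> ghat s eta k - crit / Num.sqrt k%:R <= y).
Proof.
rewrite /chat_star kbarE bigmaxe_leP; split => h k.
  by move=> kc; rewrite -lee_fin; apply: h; rewrite mem_index_iota ltnS.
by rewrite mem_index_iota ltnS lee_fin; exact: h.
Qed.

Lemma measurable_chat_star_le y :
  measurable [set s : sample | (chat_star eta F v alpha s <= y%:E)%E].
Proof.
(* The range of the maximum is random; moving its bound into each event leaves an intersection over
   a fixed set of ranks, shifted by one. *)
rewrite (_ : [set s : sample | _] = \bigcap_(k in `I_n)
    [set s : sample | ~~ (k < ncount s eta)%N ||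
      (ghat s eta k.+1 - crit / Num.sqrt k.+1%:R <= y)]).
  apply: fin_bigcap_measurable => [|k kn]; first exact: finite_II.
  apply: measurable_boolset; apply: measurable_or.
    by apply: measurable_neg; exact: measurable_ncount_ge.
  apply: measurable_fun_ler => //; apply: measurable_funB => //.
  exact: measurable_ghat.
apply/seteqP; split => s /=.
  move=> /chat_star_leP h k kn /=; have [kc|//] := boolP (k < _)%N.
  exact: h.
move=> h; apply/chat_star_leP => -[//|k] kc.
have kn : (k < n)%N := leq_trans kc (ncount_le s eta).
by have := h k kn; rewrite /= (kc : (k < _)%N).
Qed.

(** Coverage is inherited from the event that the statistic of the pure noise is at most its
    critical value: there each noise average is at most [crit / Num.sqrt k%:R], and the average of
    [g] over neighbours is at most [g 0]. *)
Lemma chat_star_coverage (g : R -> R) : 0 < alpha < 1 -> (0 < n)%N ->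
  unimodal_class g ->
  ((1 - alpha)%:E <=
    Prob F v g [set s : sample | chat_star eta F v alpha s <= (g 0%R)%:E])%E.
Proof.
move=> alpha01 n0 ug.
apply: (le_trans (crit_value_coverage F v eta alpha01 n0)).
apply: le_measure; rewrite ?inE.
- apply: measurable_boolset; apply: measurable_fun_ler => //.
  exact: measurable_max_stat.
- rewrite -[X in measurable X]setTI.
  apply: measurable_observations => //; last exact: measurable_chat_star_le.
  exact: unimodal_measurable.
move=> s /= /(max_stat_leP _ _ _ n0) h; apply/chat_star_leP => k.
rewrite ncount_observations => kc; have /andP[k0 kc'] := kc.
have kn := leq_trans kc' (ncount_le s eta).
have kR : 0 < k%:R :> R by rewrite ltr0n.
have := h k; rewrite k0 kn => /(_ isT); rewrite ghatE ?k0// kc' ghat_observations//.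
rewrite mulrC -ler_pdivlMr ?sqrtr_gt0// => hk.
rewrite lerBlDr mulrDl lerD// ler_pdivrMr// mulrC -(sum_rank_const s)//.
apply: ler_sum => j _; case: ug => [ul ur].
have [x0|x0] := leP (tnth s j).1 0; first exact: ul.
by apply: ur => //; exact: ltW.
Qed.

End star_interval.

(** * Tail bounds *)

Section design.
Context {R : realType}.
Variables (F : cumulativeBounded (0%R : R) (1%R : R)) (v : {mfun R >-> R}).
Local Open Scope ereal_scope.

Lemma law_of_cdf_itv a b : (a <= b)%R -> law_of_cdf F `]a, b]%classic = (F b - F a)%:E.
Proof.
move=> ab; rewrite /law_of_cdf /distribution /pushforward /=.
rewrite /lebesgue_stieltjes_measure /measure_extension measurable_mu_extE/=.
  by rewrite wlength_itv_bnd.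
exact: is_ocitv.
Qed.

Lemma measurable_near0 t : measurable [set p : R * R | (`|p.1| < t)%R].
Proof.
apply: measurable_boolset; apply: measurable_fun_ltr => //.
by apply: measurableT_comp => //; exact: measurable_fst.
Qed.

Lemma pair_law_near0 t :
  pair_law F v [set p : R * R | (`|p.1| < t)%R] =
  law_of_cdf F [set x : R | (`|x| < t)%R].
Proof.
have mt : measurable [set x : R | (`|x| < t)%R].
  by apply: measurable_boolset; exact: measurable_fun_ltr.
rewrite (_ : [set p : R * R | _] = [set x : R | (`|x| < t)%R] `*` setT).
  rewrite pair_lawX//; under eq_integral do rewrite probability_setT.
  by rewrite integral_cst// mul1e.
by apply/seteqP; split => p //= -[].
Qed.

Variable eta : R.
Hypothesis FvE : local_bounds eta F v.

Lemma design_mass_le t : (0 < t < eta)%R ->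
  pair_law F v [set p : R * R | (`|p.1| < t)%R] <= (t / eta)%:E.
Proof.
move=> t0; have /andP[tp _] := t0; rewrite pair_law_near0.
apply: (@le_trans _ _ (law_of_cdf F `](- t)%R, t]%classic)).
  apply: le_measure; rewrite ?inE//.
    by apply: measurable_boolset; exact: measurable_fun_ltr.
  move=> x /=; rewrite ltr_norml in_itv/= => /andP[-> xt] /=; exact: ltW.
rewrite law_of_cdf_itv ?ge0_cp// ?(ltW tp)// lee_fin.
have [/(_ t t0)/andP[_ h] _] := FvE.
by apply: le_trans h; exact: ler_norm.
Qed.

(** The open ball contains the half-open interval of half the radius, which costs the factor 2. *)
Lemma design_mass_ge t : (0 < t < eta)%R ->
  (eta * t / 2)%:E <= pair_law F v [set p : R * R | (`|p.1| < t)%R].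
Proof.
move=> /andP[t0 te]; rewrite pair_law_near0.
apply: (@le_trans _ _ (law_of_cdf F `](- (t / 2))%R, (t / 2)%R]%classic)); last first.
  apply: le_measure; rewrite ?inE//.
    by apply: measurable_boolset; exact: measurable_fun_ltr.
  move=> x /=; rewrite ltr_norml in_itv/= => /andP[tx xt].
  by apply/andP; split; lra.
have t20 : (0 < t / 2)%R by rewrite divr_gt0.
have tt : (- (t / 2) <= t / 2)%R by rewrite ge0_cp// ltW.
rewrite law_of_cdf_itv// lee_fin.
have [/(_ (t / 2)%R)] := FvE; rewrite t20 (_ : t / 2 < eta)%R; last by lra.
move=> /(_ isT)/andP[h _] _; rewrite -mulrA.
by rewrite ger0_norm// in h; rewrite subr_ge0 cumulative_is_nondecreasing.
Qed.

(** Chernoff's bound with parameter -1. Since 1 - e^(-1) is at least 1/2, each observation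
    contributes at most 1 - eta t / 4 <= exp (- eta t / 4) to the Laplace transform of the count. *)
Lemma ncount_tail n t k : (0 < t < eta)%R ->
  iid_law (pair_law F v) n [set s | (ncount s t < k)%N] <=
  (expR (k%:R - n%:R * (eta * t / 4)))%:E.
Proof.
move=> t0.
pose A := [set p : R * R | (`|p.1| < t)%R].
have mA : measurable A by exact: measurable_near0.
pose u (p : R * R) : R := if (`|p.1| < t)%R then expR (-1) else 1%R.
have u0 p : (0 <= u p)%R by rewrite /u; case: ifP => // _; exact: expR_ge0.
have mu : measurable_fun [set: R * R] u.
  apply: measurable_fun_ifT => //; apply: measurable_fun_ltr => //.
  by apply: measurableT_comp => //; exact: measurable_fst.
have Eu : \int[pair_law F v]_p (u p)%:E <= (expR (- (eta * t / 4)))%:E.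
  have eu : (expR (-1) + 2^-1 <= 1 :> R)%R.
    rewrite expRN -lerBrDr (_ : 1 - 2^-1 = 2^-1 :> R)%R; last by lra.
    by rewrite lef_pV2 ?posrE ?expR_gt0//; have := expR_ge1Dx (1 : R); lra.
  have le1 : \int[pair_law F v]_p (u p)%:E + (eta * t / 4)%:E <= 1.
    apply: (@le_trans _ _ (\int[pair_law F v]_p (u p)%:E +
        (2^-1)%:E * pair_law F v A)).
      rewrite leeD2l// (_ : eta * t / 4 = 2^-1 * (eta * t / 2))%R; last by field.
      by rewrite EFinM lee_pmul2l ?lte_fin// design_mass_ge.
    rewrite -[in X in _ * X](setIT A) -integral_indic// -ge0_integralZl//; last first.
      exact/measurable_EFinP/measurable_indic.
    rewrite -ge0_integralD//; last 3 first.
    - by move=> p _; rewrite lee_fin.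
    - exact/measurable_EFinP.
    - by apply: measurable_funeM; exact/measurable_EFinP/measurable_indic.
    apply: (@le_trans _ _ (\int[pair_law F v]_p (cst 1 p))); last first.
      by rewrite integral_cst// mul1e; exact: probability_le1.
    apply: ge0_le_integral => //.
    - by move=> p _; rewrite adde_ge0// ?mule_ge0// lee_fin.
    - apply: emeasurable_funD; first exact/measurable_EFinP.
      by apply: measurable_funeM; exact/measurable_EFinP/measurable_indic.
    move=> p _; rewrite /= -EFinM -EFinD lee_fin indicE /u.
    case: ifPn => pt; first by rewrite mem_set// mulr1.
    by rewrite memNset ?mulr0 ?addr0//; exact/negP.
  rewrite -leeBrDr// in le1; apply: (le_trans le1).
  rewrite -EFinB lee_fin; have := expR_ge1Dx (- (eta * t / 4))%R; lra.
pose f (s : n.-tuple (R * R)) : R := (\prod_(i < n) u (tnth s i))%R.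
have mf : measurable_fun setT f.
  apply: measurable_prod => i _; apply: measurableT_comp => //.
  exact: measurable_tnth.
have f0 s : (0 <= f s)%R by apply: prodr_ge0.
have fE s : f s = expR (- (ncount s t)%:R).
  rewrite /f /ncount /u -big_mkcond prodr_const.
  rewrite -[X in _ = expR X]mulrN1 expRM_natl; congr (_ ^+ _)%R.
  by apply: eq_card => i; rewrite inE.
have Ef : \int[iid_law (pair_law F v) n]_s (f s)%:E <=
    (expR (- (n%:R * (eta * t / 4))))%:E.
  rewrite /f (@ge0_integral_iid_prod _ _ _ (pair_law F v) n (fun=> u))//.
  set I := (X in \prod_(_ < _) X) in Eu *.
  have I0 : 0 <= I by apply: integral_ge0 => p _; rewrite lee_fin.
  have Ifin : I \is a fin_num by rewrite ge0_fin_numE// (le_lt_trans Eu)// ltry.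
  rewrite -(fineK Ifin) -(big_morph EFin EFinM erefl) prodr_const card_ord lee_fin.
  rewrite -mulrN expRM_natl lerXn2r ?nnegrE ?expR_ge0 ?fine_ge0//.
  by rewrite -lee_fin fineK.
have := ge0_markov (iid_law (pair_law F v) n) (expR_ge0 (- k%:R)) mf f0.
move=> /le_trans/(_ Ef).
have -> : [set s | (expR (- k%:R) <= f s)%R] = [set s | (ncount s t <= k)%N].
  by apply/seteqP; split => s; rewrite /mkset fE ler_expR lerN2 ler_nat.
rewrite (expRN k%:R) lee_pdivrMl ?expR_gt0// -EFinM -expRD => h.
apply: le_trans h; apply: le_measure; rewrite ?inE.
- apply: measurable_boolset; under eq_fun do rewrite ltnNge.
  by apply: measurable_neg; exact: measurable_ncount_ge.
- apply: measurable_boolset; under eq_fun do rewrite leqNgt.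
  by apply: measurable_neg; exact: measurable_ncount_ge.
- by move=> s /=; exact: ltnW.
Qed.

End design.

(** * Growth of logarithms *)

Section asymptotics.
Context {R : realType}.
Local Open Scope ring_scope.

Lemma near_ln (M : R) : \forall n \near \oo, M <= ln n%:R.
Proof.
exists (Num.truncn (expR M)).+1 => //= n /= Mn.
have eM : expR M <= n%:R.
  by apply/ltW/(lt_le_trans (truncnS_gt _)); rewrite ler_nat.
by rewrite -[leLHS]expRK ler_ln ?posrE ?expR_gt0// (lt_le_trans (expR_gt0 M)).
Qed.

Lemma near_lnln (M : R) : \forall n \near \oo, M <= ln (ln n%:R).
Proof.
near=> n; have eM : expR M <= ln n%:R by near: n; exact: near_ln.
by rewrite -[leLHS]expRK ler_ln ?posrE ?expR_gt0// (lt_le_trans (expR_gt0 M)).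
Unshelve. all: by end_near. Qed.

Lemma trunc_log_le_ln n : (0 < n)%N -> (trunc_log 2 n)%:R * ln 2 <= ln n%:R :> R.
Proof.
move=> n0; rewrite mulr_natl -lnXn// ler_ln ?posrE ?exprn_gt0 ?ltr0n//.
by rewrite -natrX ler_nat; exact: trunc_logP.
Qed.

End asymptotics.

Section max_statistic_tail.
Context {R : realType}.
Variables (F : cumulativeBounded (0%R : R) (1%R : R)) (v : {mfun R >-> R}).
Hypothesis v0 : forall x, 0 <= v x.
Variable eta : R.
Hypothesis eta0 : 0 < eta.
Hypothesis v_le : forall x, `|x| < eta -> v x <= eta^-1.

(* Peeling over the dyadic blocks [2^j <= k < 2^(j+1)]. *)
Lemma max_stat_tail n (a : R) : (0 < n)%N -> 0 <= a ->
  (iid_law (pair_law F v) n [set s | (a < max_stat eta s)%R] <=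
  ((trunc_log 2 n).+1%:R * expR (- (a ^+ 2 * eta / 4)))%:E)%E.
Proof.
move=> n0 a0; set J := (trunc_log 2 n).+1.
(* Within a block, k >= 2^j gives the level a sqrt (2^j) and k <= 2^(j+1) gives the horizon, so the
   deviation exponent is a^2 eta / 4 for every block. *)
pose B j : set (n.-tuple (R * R)) :=
  noise_exceeds eta (2 ^ j.+1) 1 (a * Num.sqrt (2 ^+ j)).
have mB j : measurable (B j) by exact: measurable_noise_exceeds.
apply: (@le_trans _ _ (iid_law (pair_law F v) n (\big[setU/set0]_(j < J) B j))).
  apply: le_measure; rewrite ?inE.
  - apply: measurable_boolset; apply: measurable_fun_ltr => //.
    exact: measurable_max_stat.
  - exact: bigsetU_measurable.
  move=> s /=; rewrite ltNge => /negP/(contra_not (proj2 (max_stat_leP _ _ _ n0))).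
  move=> /existsNP[k /not_implyP[kn /negP]]; rewrite -ltNge ghatE//.
  have /andP[k0 kn'] := kn.
  case: ifPn => [kc ak|_]; last by rewrite mulr0 ltNge a0.
  have kR : 0 < k%:R :> R by rewrite ltr0n.
  have /andP[jk kj] := trunc_log_bounds (ltnSn 1) k0.
  rewrite -bigcup_mkord; exists (trunc_log 2 k) => /=.
    by rewrite ltnS leq_trunc_log.
  exists k; split => //; first by rewrite k0 ltnW.
  rewrite mul1r; have sk : Num.sqrt k%:R ^+ 2 = k%:R :> R by rewrite sqr_sqrtr// ltW.
  have sk0 : 0 < Num.sqrt k%:R :> R by rewrite sqrtr_gt0.
  have : a * Num.sqrt k%:R <= noise_sum s k.
    rewrite -ler_pdivlMr//; apply/ltW/(lt_le_trans ak); rewrite -{2}sk.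
    rewrite le_eqVlt; apply/predU1P; left; field.
    by rewrite gt_eqF.
  apply: le_trans; rewrite ler_wpM2l// ler_sqrt; last exact: ltW.
  by rewrite -natrX ler_nat.
apply: (le_trans (Boole_inequality _ (fun j _ => mB j))).
apply: (@le_trans _ _ (\sum_(j < J) (expR (- (a ^+ 2 * eta / 4)))%:E)%E).
  apply: lee_sum => j _.
  apply: (le_trans (noise_deviation F v0 eta0 v_le n _ _ _)).
  - by rewrite expn_gt0.
  - by rewrite expr1n.
  - by rewrite mulr_ge0// sqrtr_ge0.
  rewrite lee_fin ler_expR lerN2 exprMn sqr_sqrtr ?exprn_ge0//.
  rewrite natrX (exprS _ j) le_eqVlt; apply/predU1P; left; field.
  by rewrite expf_neq0.
by rewrite sumEFin lee_fin sumr_const card_ord mulr_natl.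
Qed.

(** The constant [8 / eta] makes the deviation exponent equal to 2 ln ln n. Each block then costs
    (ln n)^(-2), and the at most [C * ln n] blocks together cost at most [C / ln n%:R], eventually
    below [alpha]. *)
Lemma crit_value_asymptotic alpha : 0 < alpha < 1 ->
  \forall n \near \oo, crit_value eta F v alpha n <=
    Num.sqrt (8 / eta) * Num.sqrt (ln (ln n%:R)).
Proof.
move=> alpha01; have /andP[alpha0 alpha1] := alpha01.
pose C : R := 1 + (ln 2)^-1.
have l2 : 0 < ln 2 :> R by rewrite ln_gt0// ltr1n.
have C0 : 0 < C by rewrite addr_gt0// invr_gt0.
near=> n.
have n0 : (0 < n)%N by near: n; exact: nbhs_infty_gt.
have x1 : 1 <= ln n%:R :> R by near: n; exact: near_ln.
have x0 : 0 < ln n%:R :> R by rewrite (lt_le_trans ltr01).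
have xC : C / alpha <= ln n%:R by near: n; exact: near_ln.
have ll0 : 0 <= ln (ln n%:R) :> R by near: n; exact: near_lnln.
apply: crit_value_le => //.
set a := _ * _.
have a0 : 0 <= a by rewrite mulr_ge0// sqrtr_ge0.
have mA : measurable [set s : n.-tuple (R * R) | (a < max_stat eta s)%R].
  apply: measurable_boolset; apply: measurable_fun_ltr => //.
  exact: measurable_max_stat.
rewrite (_ : [set s | _] = ~` [set s : n.-tuple (R * R) | (a < max_stat eta s)%R]).
  rewrite probability_setC// EFinB leeB//.
  apply: (le_trans (max_stat_tail n0 a0)).
  rewrite lee_fin.
  have -> : a ^+ 2 * eta / 4 = ln (ln n%:R) *+ 2.
    rewrite /a exprMn !sqr_sqrtr// ?divr_ge0// ?ltW//.
    by field; rewrite gt_eqF.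
  rewrite expRN -lnXn// lnK ?posrE ?exprn_gt0// ler_pdivrMr ?exprn_gt0//.
  have := trunc_log_le_ln (R := R) n0; rewrite -ler_pdivlMr// => tl.
  apply: (@le_trans _ _ (C * ln n%:R)).
    by rewrite -addn1 natrD addrC /C mulrDl mul1r lerD// mulrC.
  by rewrite expr2 mulrA ler_pM2r// mulrC -ler_pdivrMr.
by apply/seteqP; split => s /=; rewrite leNgt => /negP.
Unshelve. all: by end_near. Qed.

End max_statistic_tail.

(** * Rates and the adaptive upper bound *)

Section rate.
Context {R : realType}.
Implicit Types beta : R.

Definition lograte n : R := ln (n%:R / ln (ln n%:R)).

(* The bandwidth balancing bias [t^beta] and noise [sqrt (ln ln n / (n t))]. *)
Definition bandwidth n beta : R := expR (- (lograte n / (2 * beta + 1))).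

Lemma near_lograte : \forall n \near \oo, ln n%:R / 2 <= lograte n.
Proof.
near=> n.
have x4 : 4 * ln 4 + 1 <= ln n%:R :> R by near: n; exact: near_ln.
have l1 : 1 <= ln (ln n%:R) :> R by near: n; exact: near_lnln.
have n0 : 0 < n%:R :> R by rewrite ltr0n; near: n; exact: nbhs_infty_gt.
have l0 : 0 < ln (ln n%:R) :> R by exact: lt_le_trans l1.
have l4 : 0 < ln 4 :> R by rewrite ln_gt0// ltr1n.
have x0 : 0 < ln n%:R :> R by rewrite (lt_le_trans _ x4)// addr_gt0// mulr_gt0.
rewrite /lograte ln_div ?posrE//.
have := ln_sublinear l0; have := ln_sublinear (divr_gt0 x0 (ltr0Sn _ 3)).
rewrite ln_div ?posrE//; lra.
Unshelve. all: by end_near. Qed.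

Lemma near_lograte_ge M : \forall n \near \oo, M <= lograte n.
Proof.
near=> n; have : 2 * M <= ln n%:R by near: n; exact: near_ln.
have : ln n%:R / 2 <= lograte n by near: n; exact: near_lograte.
lra.
Unshelve. all: by end_near. Qed.

Lemma rateE n beta : 0 < n%:R / ln (ln n%:R) :> R ->
  rate n beta = expR (- (lograte n * (beta / (2 * beta + 1)))).
Proof. by move=> n0; rewrite /rate /powR gt_eqF// mulNr mulrC. Qed.

Lemma bandwidth_powR n beta : 0 < n%:R / ln (ln n%:R) :> R ->
  bandwidth n beta `^ beta = rate n beta.
Proof.
by move=> n0; rewrite rateE// -expRM mulNr -mulrA (mulrC _^-1).
Qed.

(** The noise half of the balance: sqrt (ln ln n / (n t)) is exactly the rate, just as
    [bandwidth_powR] says for the bias. *)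
Lemma bandwidth_variance n beta : 0 < ln (ln n%:R) :> R -> (0 < n)%N ->
  2 * beta + 1 != 0 ->
  n%:R * bandwidth n beta * rate n beta ^+ 2 = ln (ln n%:R).
Proof.
move=> l0 n0 b0; have nR : 0 < n%:R :> R by rewrite ltr0n.
have nl : 0 < n%:R / ln (ln n%:R) :> R by rewrite divr_gt0.
rewrite rateE// -expRM_natl -mulrA -expRD.
rewrite (_ : _ + _ = - lograte n); last by field.
rewrite expRN /lograte lnK ?posrE// invf_div mulrC mulfVK//.
by rewrite gt_eqF.
Qed.

End rate.

Section upper_bound.
Context {R : realType}.
Variables (F : cumulativeBounded (0%R : R) (1%R : R)) (v : {mfun R >-> R}).
Hypothesis v0 : forall x, 0 <= v x.
Variables (eta L : R).
Hypotheses (eta0 : 0 < eta) (L0 : 0 < L).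
Hypothesis FvE : local_bounds eta F v.

Let v_le x : `|x| < eta -> v x <= eta^-1.
Proof. by have [_ h] := FvE; move=> /h/andP[]. Qed.

(** [L] pays for the bias, [Num.sqrt (8 / eta)] for the critical value and the inner 1 for the
    noise. The factor [Num.sqrt (16 / eta)] comes from averaging over at least eta n t / 16
    neighbours, and the last 1 makes the inequality strict. *)
Definition upper_constant : R := L + (Num.sqrt (8 / eta) + 1) * Num.sqrt (16 / eta) + 1.

(** The deterministic half of the argument: the maximum is bounded below by a single rank [k],
    chosen with knowledge of [beta] although [chat_star] does not know it. *)
Lemma chat_star_gt alpha n k beta (g : R -> R) (s : n.-tuple (R * R)) t ll :
  0 < beta -> holder_class L beta g -> (0 < k)%N -> 0 <= ll ->
  crit_value eta F v alpha n <= Num.sqrt (8 / eta) * Num.sqrt ll ->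
  t <= eta -> (k <= ncount s t)%N ->
  ~ noise_exceeds eta k (-1) (Num.sqrt (k%:R * ll)) s ->
  ((g 0%R - (L * t `^ beta + (Num.sqrt (8 / eta) + 1) * Num.sqrt (ll / k%:R)))%:E <=
    chat_star eta F v alpha (observations g s))%E.
Proof.
move=> b0 gL k0 ll0 critle teta kt noise.
have kR : 0 < k%:R :> R by rewrite ltr0n.
have kc : (k <= ncount s eta)%N.
  apply: (leq_trans kt); apply: fintype.subset_leq_card.
  by apply/fintype.subsetP => i; rewrite !inE => /lt_le_trans; exact.
have sk0 : 0 < Num.sqrt k%:R :> R by rewrite sqrtr_gt0.
have noise_ge : - Num.sqrt (k%:R * ll) <= noise_sum s k.
  rewrite lerNl leNgt; apply/negP => h; apply: noise; exists k; split.
  - by rewrite k0/=.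
  - exact: kc.
  - by rewrite mulN1r ltW.
have bias : k%:R * (g 0 - L * t `^ beta) <=
    \sum_(j < n | (absX_rank s j <= k)%N) g (tnth s j).1.
  rewrite -(sum_rank_const s) ?(leq_trans kc) ?ncount_le//.
  apply: ler_sum => j jk; rewrite lerBlDr -lerBlDl.
  have xt : `|(tnth s j).1| < t by apply: (absX_rank_ncount (k := k)); rewrite jk.
  apply: (le_trans (ler_norm _)); apply: (le_trans (gL _ _)).
  rewrite sub0r normrN ler_wpM2l ?(ltW L0)//.
  by rewrite ge0_ler_powR ?nnegrE ?(ltW b0)// ?ltW// (le_lt_trans _ xt).
pose y := ghat (observations g s) eta k - crit_value eta F v alpha n / Num.sqrt k%:R.
apply: (@le_trans _ _ y%:E); last first.
  rewrite /y /chat_star kbarE ncount_observations.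
  by apply: (proj1 (bigmaxe_leP _ _ _) (lexx _)); rewrite mem_index_iota k0.
rewrite lee_fin /y ghat_observations ?k0//.
have -> : Num.sqrt (ll / k%:R) = Num.sqrt ll / Num.sqrt k%:R.
  by rewrite sqrtrM// sqrtrV// ltW.
have kk : k%:R = Num.sqrt k%:R ^+ 2 :> R by rewrite sqr_sqrtr// ltW.
have h1 : g 0 - L * t `^ beta - Num.sqrt ll / Num.sqrt k%:R <=
    (\sum_(j < n | (absX_rank s j <= k)%N) g (tnth s j).1 + noise_sum s k) / k%:R.
  rewrite ler_pdivlMr// [leLHS]mulrC mulrBr; apply: lerD => //.
  apply: le_trans noise_ge; rewrite lerN2 sqrtrM ?(ltW kR)//.
  rewrite {2}kk le_eqVlt; apply/predU1P; left; field.
  by rewrite gt_eqF.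
have h2 : crit_value eta F v alpha n / Num.sqrt k%:R <=
    Num.sqrt (8 / eta) * (Num.sqrt ll / Num.sqrt k%:R).
  by rewrite mulrA ler_pM2r// invr_gt0.
lra.
Qed.

(** The threshold on [n] is fixed before [beta] and [g], as the infimum over both requires. Failure
    needs too few neighbours or too negative a noise sum; each has probability at most
    [delta / 2]. *)
Lemma chat_star_rate alpha eps delta : 0 < alpha < 1 -> 0 < eps <= 1 -> 0 < delta ->
  \forall n \near \oo, forall beta g, eps <= beta <= 1 ->
    holder_class L beta g -> unimodal_class g ->
    ((1 - delta)%:E <= Prob F v g [set s : n.-tuple (R * R) |
      ((g 0%R - upper_constant * rate n beta)%:E < chat_star eta F v alpha s)%E])%E.
Proof.
move=> alpha01 /andP[eps0 eps1] delta0.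
have d20 : 0 < delta / 2 by rewrite divr_gt0.
(* Once [M <= W], the part 1 gives at least one neighbour to average, and the other part bounds the
   probability exp (k - 2 W) <= exp (- W) of too few neighbours. *)
pose M : R := Num.max 1 (- ln (delta / 2)).
have M1 : 1 <= M by rewrite le_max lexx.
have M0 : 0 < M := lt_le_trans ltr01 M1.
near=> n => beta g /andP[eb b1] gL ug.
have n0 : (0 < n)%N by near: n; exact: nbhs_infty_gt.
have nR : 0 < n%:R :> R by rewrite ltr0n.
have critle : crit_value eta F v alpha n <=
    Num.sqrt (8 / eta) * Num.sqrt (ln (ln n%:R)).
  by near: n; exact: crit_value_asymptotic.
have ll1 : 1 <= ln (ln n%:R) :> R by near: n; exact: near_lnln.
have ll0 : 0 < ln (ln n%:R) :> R := lt_le_trans ltr01 ll1.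
have nl : 0 < n%:R / ln (ln n%:R) :> R by rewrite divr_gt0.
have b0 : 0 < beta := lt_le_trans eps0 eb.
have b21 : 0 < 2 * beta + 1 by rewrite addr_gt0// mulr_gt0.
(* As 2 beta + 1 <= 3, this puts every bandwidth below [eta]. The next bound, through 2 beta / (2
   beta + 1) >= 2 eps / 3, makes n t large uniformly in [beta]. *)
have lam_eta : 3 * (1 + `|ln eta|) <= lograte n by near: n; exact: near_lograte_ge.
have lam_M : 3 / (2 * eps) * ln (8 * M / eta) <= lograte n.
  by near: n; exact: near_lograte_ge.
have lam0 : 0 <= lograte n :> R by near: n; exact: near_lograte_ge.
have ll_d : - (2 * ln (delta / 2)) / eta <= ln (ln n%:R) by near: n; exact: near_lnln.
set ll := ln (ln n%:R) in critle ll1 ll0 nl ll_d *.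
set t := bandwidth n beta.
have t0 : 0 < t by exact: expR_gt0.
have te : t < eta.
  rewrite -[ltRHS]lnK ?posrE// ltr_expR ltrNl ltr_pdivlMr//.
  apply: (@le_lt_trans _ _ (`|ln eta| * 3)); last by lra.
  apply: (@le_trans _ _ (`|ln eta| * (2 * beta + 1))).
    by rewrite ler_pM2r// -normrN ler_norm.
  by rewrite ler_wpM2l//; lra.
(* Half the guaranteed exponent n eta t / 4 of [ncount_tail], leaving room for [k] close to [W]. *)
set W := eta * (n%:R * t) / 8.
have WM : M <= W.
  rewrite /W ler_pdivlMr// [leRHS]mulrC -ler_pdivrMr//.
  have -> : n%:R * t = ll * expR (lograte n - lograte n / (2 * beta + 1)).
    by rewrite expRD [expR (lograte n)]lnK ?posrE// mulrA (mulrC ll) divfK// gt_eqF.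
  apply: (@le_trans _ _ (expR (2 * eps / 3 * lograte n))).
    rewrite -[leLHS]lnK ?posrE ?divr_gt0 ?mulr_gt0// ler_expR.
    by rewrite (mulrC M) -ler_pdivrMl ?divr_gt0 ?mulr_gt0// invf_div.
  apply: (@le_trans _ _ (expR (lograte n - lograte n / (2 * beta + 1)))).
    rewrite ler_expR (_ : lograte n - _ = 2 * beta / (2 * beta + 1) * lograte n).
      rewrite ler_wpM2r// ler_pdivlMr// mulrAC ler_pdivrMr//.
      by apply: ler_pM; rewrite ?mulr_ge0 ?(ltW eps0) ?(ltW b21)//; lra.
    by field; rewrite gt_eqF.
  by rewrite ler_peMl ?expR_ge0.
pose k := Num.truncn W.
have W0 : 0 <= W by rewrite (le_trans _ WM)// ltW.
have /andP[kW Wk] := truncn_itv W0.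
have k0 : (0 < k)%N by rewrite truncn_gt0 (le_trans M1).
have kR : 0 < k%:R :> R by rewrite ltr0n.
have Wk2 : W <= 2 * k%:R.
  have : 1 <= k%:R :> R by rewrite ler1n.
  by move: Wk; rewrite -/k -natr1; lra.
pose E1 : set (n.-tuple (R * R)) := [set s | (ncount s t < k)%N].
pose E2 : set (n.-tuple (R * R)) := noise_exceeds eta k (-1) (Num.sqrt (k%:R * ll)).
have mE1 : measurable E1.
  apply: measurable_boolset; under eq_fun do rewrite ltnNge.
  by apply: measurable_neg; exact: measurable_ncount_ge.
have mE2 : measurable E2 by exact: measurable_noise_exceeds.
have PE1 : (iid_law (pair_law F v) n E1 <= (delta / 2)%:E)%E.
  apply: (le_trans (ncount_tail FvE n k _)); first by rewrite t0.
  rewrite lee_fin -[leRHS]lnK ?posrE// ler_expR.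
  have -> : n%:R * (eta * t / 4) = 2 * W by rewrite /W; field.
  have : - ln (delta / 2) <= W by rewrite (le_trans _ WM)// le_max lexx orbT.
  lra.
have PE2 : (iid_law (pair_law F v) n E2 <= (delta / 2)%:E)%E.
  apply: (le_trans (noise_deviation F v0 eta0 v_le n k0 _ _)).
  - by rewrite sqrrN expr1n.
  - exact: sqrtr_ge0.
  rewrite lee_fin -[leRHS]lnK ?posrE// ler_expR sqr_sqrtr; last first.
    by rewrite mulr_ge0// ltW.
  rewrite (_ : k%:R * ll * eta / (2 * k%:R) = ll * eta / 2); last first.
    by field; rewrite gt_eqF.
  by move: ll_d; rewrite ler_pdivrMr//; lra.
set C := upper_constant * rate n beta.
pose G : set (n.-tuple (R * R)) :=
  [set s | (chat_star eta F v alpha s <= (g 0%R - C)%:E)%E].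
have mG : measurable G by exact: measurable_chat_star_le.
have mobsG : measurable (observations g (n := n) @^-1` G).
  rewrite -[X in measurable X]setTI; apply: measurable_observations => //.
  exact: unimodal_measurable.
have sub : observations g (n := n) @^-1` G `<=` E1 `|` E2.
  move=> s Gs; apply: contrapT => /not_orP[/= /negP]; rewrite -leqNgt => kt noise.
  have := chat_star_gt b0 gL k0 (ltW ll0) critle (ltW te) kt noise.
  move=> /le_trans/(_ Gs); rewrite lee_fin leNgt => /negP; apply.
  rewrite ltrD2l ltrN2 /C /upper_constant bandwidth_powR//.
  set r := rate n beta; have r0 : 0 < r by rewrite /r rateE// expR_gt0.
  suff : Num.sqrt (ll / k%:R) <= Num.sqrt (16 / eta) * r.
    have := sqrtr_ge0 (8 / eta); nra.
  rewrite (_ : _ * r = Num.sqrt (16 / eta * r ^+ 2)); last first.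
    by rewrite [RHS]sqrtrM ?sqrtr_sqr ?gtr0_norm// divr_ge0// ltW.
  rewrite ler_sqrt; last by rewrite mulr_ge0 ?sqr_ge0 ?divr_ge0 ?(ltW eta0).
  rewrite ler_pdivrMr//.
  rewrite /ll -(bandwidth_variance ll0 n0 (lt0r_neq0 b21)) -/r -/t.
  rewrite [leRHS]mulrAC ler_pM2r ?exprn_gt0//.
  by rewrite [leRHS]mulrAC ler_pdivlMr//; move: Wk2; rewrite /W; lra.
rewrite /Prob (_ : _ @^-1` _ = ~` (observations g (n := n) @^-1` G)); last first.
  by apply/seteqP; split => s /=; rewrite ltNge => /negP.
rewrite probability_setC// EFinB leeB//.
apply: (@le_trans _ _ (iid_law (pair_law F v) n (E1 `|` E2))).
  by apply: le_measure; rewrite ?inE//; exact: measurableU.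
apply: (le_trans (measureU2 _ mE1 mE2)).
by rewrite [leRHS](_ : _ = (delta / 2)%:E + (delta / 2)%:E)%E ?leeD// -EFinD -splitr.
Unshelve. all: by end_near. Qed.

End upper_bound.

(** * Likelihood ratios and the lower bound *)

Section likelihood.
Context {R : realType}.
Variables (F : cumulativeBounded (0%R : R) (1%R : R)) (v : {mfun R >-> R}).
Hypothesis v0 : forall x, 0 <= v x.
Local Open Scope ereal_scope.

Definition likelihood (l : R -> R) n (s : n.-tuple (R * R)) : R :=
  \prod_(i < n) expR (l (tnth s i).1 * (tnth s i).2 -
                      l (tnth s i).1 ^+ 2 * v (tnth s i).1 / 2).

Let tilt1 (l : R -> R) (p : R * R) : R :=
  expR (l p.1 * p.2 - l p.1 ^+ 2 * v p.1 / 2).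

Let mv1 : measurable_fun [set: R * R] (fun p : R * R => v p.1).
Proof. by apply: (measurableT_comp (f := v)) => //; exact: measurable_fst. Qed.

Let ml1 (l : R -> R) : measurable_fun [set: R] l ->
  measurable_fun [set: R * R] (fun p : R * R => l p.1).
Proof. by move=> ml; apply: measurableT_comp => //; exact: measurable_fst. Qed.

Let measurable_tilt1 l : measurable_fun [set: R] l ->
  measurable_fun [set: R * R] (tilt1 l).
Proof.
move=> ml; have mlf := ml1 ml; apply: measurableT_comp => //.
apply: measurable_funB.
  by apply: measurable_funM => //; exact: measurable_snd.
apply: measurable_funM => //; apply: measurable_funM => //.
exact: measurable_funX.
Qed.

Lemma likelihood_ge0 l n (s : n.-tuple (R * R)) : (0 <= likelihood l s)%R.
Proof. by apply: prodr_ge0 => i _; exact: expR_ge0. Qed.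

Lemma measurable_likelihood l n : measurable_fun [set: R] l ->
  measurable_fun [set: n.-tuple (R * R)] (@likelihood l n).
Proof.
move=> ml; apply: measurable_prod => i _.
apply: (@measurableT_comp _ _ _ _ _ _ (tilt1 l)); first exact: measurable_tilt1.
exact: measurable_tnth.
Qed.

Lemma integral_likelihood l n : measurable_fun [set: R] l ->
  \int[iid_law (pair_law F v) n]_s (likelihood l s)%:E = 1.
Proof.
move=> ml; rewrite /likelihood.
rewrite (@ge0_integral_iid_prod _ _ _ _ n (fun=> tilt1 l)); last 2 first.
- by move=> _; exact: measurable_tilt1.
- by move=> _ p; exact: expR_ge0.
rewrite big1// => _ _; under eq_integral do rewrite -[(tilt1 _ _)%:E]mule1.
rewrite (pair_law_tilt F v0 (f := fun=> 1))//.
by rewrite integral_cst// mul1e; exact: (probability_setT (pair_law F v)).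
Qed.

(** Per observation, the product of two tilts has mean E exp (l1 l2 v), and the exponent vanishes
    outside the ball of radius [h]. For u <= 1/2, exp u <= 1/(1 - u) <= 1 + 2 u, so this mean is at
    most 1 + 2 u h / eta. *)
Lemma integral_likelihoodM (l1 l2 : R -> R) n (u h eta : R) :
  measurable_fun [set: R] l1 -> measurable_fun [set: R] l2 ->
  local_bounds eta F v -> (0 < eta)%R -> (0 <= u <= 2^-1)%R -> (0 < h < eta)%R ->
  (forall x, `|x| < h -> l1 x * l2 x * v x <= u)%R ->
  (forall x, h <= `|x| -> l1 x * l2 x * v x = 0)%R ->
  \int[iid_law (pair_law F v) n]_s (likelihood l1 s * likelihood l2 s)%:E <=
  (expR (n%:R * (2 * u * (h / eta))))%:E.
Proof.
move=> ml1' ml2' FvE eta0 /andP[u0 u1] h0 le_u eq0.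
under eq_integral do rewrite /likelihood -big_split/=.
rewrite (@ge0_integral_iid_prod _ _ _ _ n (fun _ p => tilt1 l1 p * tilt1 l2 p)%R); last 2 first.
- by move=> _; apply: measurable_funM; exact: measurable_tilt1.
- by move=> _ p; rewrite mulr_ge0 ?expR_ge0.
set A := [set p : R * R | (`|p.1| < h)%R].
have mA : measurable A by exact: measurable_near0.
have mlv : measurable_fun [set: R * R] (fun p : R * R => (expR (l1 p.1 * l2 p.1 * v p.1))%:E).
  apply/measurable_EFinP; apply: measurableT_comp => //.
  by apply: measurable_funM => //; apply: measurable_funM; exact: ml1.
(* Tilting by [l1] shifts the noise inside the second tilt and so creates the cross term; tilting by
   [l2] then absorbs the rest, because the cross term is free of noise. *)
have cross : \int[pair_law F v]_p (tilt1 l1 p * tilt1 l2 p)%:E =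
    \int[pair_law F v]_p (expR (l1 p.1 * l2 p.1 * v p.1))%:E.
  under eq_integral do rewrite EFinM.
  rewrite (pair_law_tilt F v0 (f := fun p => (tilt1 l2 p)%:E))//; last 2 first.
  - by apply/measurable_EFinP; exact: measurable_tilt1.
  - by move=> p; rewrite lee_fin expR_ge0.
  rewrite -[RHS](pair_law_tilt F v0 (l := l2)
    (f := fun p => (expR (l1 p.1 * l2 p.1 * v p.1))%:E))//.
  apply: eq_integral => p _; rewrite /tilt1 /= -EFinM -expRD; congr (expR _)%:E.
  ring.
have le1 : \int[pair_law F v]_p (expR (l1 p.1 * l2 p.1 * v p.1))%:E <=
    (expR (2 * u * (h / eta)))%:E.
  apply: (@le_trans _ _ (\int[pair_law F v]_p (1 + (2 * u)%:E * (\1_A p)%:E))).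
    apply: ge0_le_integral => //.
    - apply: emeasurable_funD => //; apply: measurable_funeM.
      exact/measurable_EFinP/measurable_indic.
    move=> p _; rewrite -EFinM -EFinD lee_fin indicE.
    have [pA|pA] := boolP (p \in A); last first.
      rewrite eq0 ?expR0 ?mulr0 ?addr0// leNgt; apply/negP => ph.
      by move/negP: pA; apply; rewrite inE.
    rewrite inE in pA; rewrite mulr1.
    apply: (@le_trans _ _ (expR u)); first by rewrite ler_expR le_u.
    have : (1 - u <= expR (- u))%R by have := expR_ge1Dx (- u)%R.
    rewrite expRN => h1.
    have h2 : (expR u <= (1 - u)^-1)%R.
      by rewrite -[leLHS]invrK lef_pV2 ?posrE ?invr_gt0 ?expR_gt0//; lra.
    apply: (le_trans h2); rewrite -div1r ler_pdivrMr; [nra|lra].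
  rewrite ge0_integralD//; last 2 first.
  - by move=> p _; rewrite -EFinM lee_fin mulr_ge0// mulr_ge0.
  - by apply: measurable_funeM; exact/measurable_EFinP/measurable_indic.
  have int1 : \int[pair_law F v]_p (1 : \bar R) = 1.
    by rewrite integral_cst// mul1e; exact: (probability_setT (pair_law F v)).
  rewrite [X in X + _]int1.
  rewrite ge0_integralZl//; last 2 first.
  - exact/measurable_EFinP/measurable_indic.
  - by rewrite lee_fin mulr_ge0.
  rewrite integral_indic// setIT.
  apply: (@le_trans _ _ (1 + (2 * u)%:E * (h / eta)%:E)).
    rewrite leeD2l// lee_wpmul2l ?lee_fin ?mulr_ge0//.
    exact: (design_mass_le FvE h0).
  by rewrite -EFinM -EFinD lee_fin expR_ge1Dx.
rewrite -cross in le1; set I := (X in X <= _) in le1 *.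
have I0 : 0 <= I by apply: integral_ge0 => p _; rewrite lee_fin mulr_ge0 ?expR_ge0.
have Ifin : I \is a fin_num by rewrite ge0_fin_numE// (le_lt_trans le1)// ltry.
have powI J : J = I -> \prod_(i < n) J = (fine I ^+ n)%:E.
  by move=> ->; rewrite -[in LHS](fineK Ifin) prodEFin prodr_const card_ord.
rewrite (powI _ erefl) lee_fin expRM_natl.
rewrite lerXn2r ?nnegrE ?expR_ge0 ?fine_ge0//.
by rewrite -lee_fin fineK.
Qed.

End likelihood.

Section mixture_test.
Context {R : realType}.
Variables (F : cumulativeBounded (0%R : R) (1%R : R)) (v : {mfun R >-> R}).
Hypothesis v0 : forall x, 0 <= v x.

(* With [S] the sum of the [m] likelihood ratios, integrating
   [0 <= (S - m * (1 + 2 * delta * \1_A)) ^+ 2] bounds [S * \1_A] by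
   [\1_A] plus a multiple of [S ^+ 2 - m ^+ 2]. *)
Lemma mixture_test_bound m n (l g : 'I_m -> R -> R) (A : set (n.-tuple (R * R)))
    (x p delta rho : R) :
  (0 < m)%N -> (0 < delta)%R -> measurable A ->
  (forall i, measurable_fun [set: R] (l i)) ->
  (forall i, measurable_fun [set: R] (g i)) ->
  (forall i x, (l i x * v x = g i x)%R) ->
  (forall i, (x%:E <= Prob F v (g i) A)%E) ->
  iid_law (pair_law F v) n A = p%:E ->
  (\sum_(i < m) \sum_(j < m) \int[iid_law (pair_law F v) n]_s
    (likelihood v (l i) s * likelihood v (l j) s)%:E <=
    (m%:R ^+ 2 * (1 + rho))%:E)%E ->
  (x <= (1 + delta) * p + rho / (4 * delta))%R.
Proof.
move=> m0 d0 mA ml mg lg xP PA second.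
pose D i (s : n.-tuple (R * R)) : R := likelihood v (l i) s.
pose S s : R := \sum_(i < m) D i s.
have D0 i s : (0 <= D i s)%R by exact: likelihood_ge0.
have S0 s : (0 <= S s)%R by apply: sumr_ge0.
have mD i : measurable_fun setT (D i) by exact: measurable_likelihood.
have mS : measurable_fun setT S by exact: measurable_sum.
have mR : (0 < m%:R :> R)%R by rewrite ltr0n.
have m1A : measurable_fun setT (\1_A : n.-tuple (R * R) -> R) by exact: measurable_indic.
pose M : R := m%:R.
have pw s : (4 * delta * M * (S s * \1_A s) + 2 * M * S s <=
    4 * delta * (1 + delta) * M ^+ 2 * \1_A s + (S s ^+ 2 + M ^+ 2))%R.
  rewrite -subr_ge0; have [s01|s01] : \1_A s = 0%R :> R \/ \1_A s = 1%R :> R.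
  - by rewrite indicE; case: (_ \in _); [right|left].
  - rewrite s01 (_ : _ - _ = (S s - M) ^+ 2)%R; first exact: sqr_ge0.
    ring.
  - rewrite s01 (_ : _ - _ = (S s - M * (1 + 2 * delta)) ^+ 2)%R.
      exact: sqr_ge0.
    ring.
pose P := iid_law (pair_law F v) n.
have ES : (\int[P]_s (S s)%:E = M%:E)%E.
  under eq_integral do rewrite /S -sumEFin.
  rewrite ge0_integral_sum//; last 2 first.
  - by move=> i; exact/measurable_EFinP.
  - by move=> i s _; rewrite lee_fin.
  under eq_bigr do rewrite (integral_likelihood F v0)//.
  by rewrite sumEFin sumr_const card_ord.
have ES2 : (\int[P]_s (S s ^+ 2)%:E <= (M ^+ 2 * (1 + rho))%:E)%E.
  apply: le_trans second; rewrite le_eqVlt; apply/predU1P; left.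
  under eq_integral do rewrite expr2 /S mulr_suml -sumEFin.
  rewrite ge0_integral_sum//; last 2 first.
  - by move=> i; apply/measurable_EFinP; exact: (measurable_funM (mD i) mS).
  - by move=> i s _; rewrite lee_fin mulr_ge0// -/(S s).
  apply: eq_bigr => i _; under eq_integral do rewrite mulr_sumr -sumEFin.
  rewrite ge0_integral_sum//.
  - by move=> j; apply/measurable_EFinP; exact: measurable_funM.
  - by move=> j s _; rewrite lee_fin mulr_ge0.
have ESA : ((M * x)%:E <= \int[P]_s (S s * \1_A s)%:E)%E.
  under eq_integral do rewrite /S mulr_suml -sumEFin.
  rewrite ge0_integral_sum//; last 2 first.
  - by move=> i; apply/measurable_EFinP; exact: measurable_funM.
  - by move=> i s _; rewrite lee_fin mulr_ge0.
  apply: (@le_trans _ _ (\sum_(i < m) x%:E)%E).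
    by rewrite sumEFin sumr_const card_ord -mulr_natl.
  apply: lee_sum => i _; rewrite (le_trans (xP i))//.
  rewrite (Prob_density F v0 (ml i) (mg i) (lg i) mA).
  by under [leRHS]eq_integral do rewrite EFinM.
have EA : (\int[P]_s (\1_A s)%:E = p%:E)%E by rewrite integral_indic// setIT.
have intZD (a b c : R) (f h : n.-tuple (R * R) -> R) : 0 <= a -> 0 <= b -> 0 <= c ->
    measurable_fun setT f -> measurable_fun setT h ->
    (forall s, 0 <= f s) -> (forall s, 0 <= h s) ->
    (\int[P]_s (a * f s + b * h s + c)%:E =
      a%:E * \int[P]_s (f s)%:E + b%:E * \int[P]_s (h s)%:E + c%:E)%E.
  move=> a0 b0 c0 mf mh f0 h0.
  have maf : measurable_fun setT (fun s => (a * f s)%:E).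
    by apply/measurable_EFinP; exact: measurable_funM.
  have mbh : measurable_fun setT (fun s => (b * h s)%:E).
    by apply/measurable_EFinP; exact: measurable_funM.
  under eq_integral do rewrite 2!EFinD.
  have af0 s : (0 <= (a * f s)%:E)%E by rewrite lee_fin mulr_ge0.
  have bh0 s : (0 <= (b * h s)%:E)%E by rewrite lee_fin mulr_ge0.
  rewrite ge0_integralD//; last 2 first.
  - by move=> s _; rewrite adde_ge0.
  - exact: emeasurable_funD.
  rewrite ge0_integralD//.
  under eq_integral do rewrite EFinM.
  rewrite ge0_integralZl//; last 2 first.
  - exact/measurable_EFinP.
  - by move=> s _; rewrite lee_fin.
  under [X in (_ + X + _ = _)%E]eq_integral do rewrite EFinM.
  rewrite ge0_integralZl//; last 2 first.
  - exact/measurable_EFinP.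
  - by move=> s _; rewrite lee_fin.
  congr (_ + _ + _)%E; rewrite integral_cst//.
  by rewrite [X in (_ * X)%E](probability_setT P) mule1.
have M0 : 0 <= M by exact: ltW.
have one0 s : 0 <= \1_A s :> R by rewrite indicE.
have mSA : measurable_fun setT (fun s => S s * \1_A s) by exact: measurable_funM.
have mS2 : measurable_fun setT (fun s => S s ^+ 2) by exact: measurable_funX.
have int_le : (\int[P]_s (4 * delta * M * (S s * \1_A s) + 2 * M * S s + 0)%:E <=
    \int[P]_s (4 * delta * (1 + delta) * M ^+ 2 * \1_A s + 1 * S s ^+ 2 + M ^+ 2)%:E)%E.
  apply: ge0_le_integral.
  - exact: measurableT.
  - by move=> s _; rewrite lee_fin !addr_ge0// ?mulr_ge0// ltW.
  - apply/measurable_EFinP; apply: measurable_funD => //.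
    by apply: measurable_funD; exact: measurable_funM.
  - apply/measurable_EFinP; apply: measurable_funD => //.
    by apply: measurable_funD; exact: measurable_funM.
  - by move=> s _; rewrite lee_fin addr0 mul1r -[leRHS]addrA.
have c0 : 0 <= 4 * delta * (1 + delta) * M ^+ 2.
  by rewrite !mulr_ge0// ?exprn_ge0// ?ltW// addr_gt0.
have c1 : 0 <= 4 * delta * M by rewrite !mulr_ge0// ltW.
have c2 : 0 <= 2 * M by rewrite mulr_ge0.
move: int_le; rewrite !intZD ?exprn_ge0//; last 2 first.
- by move=> s; exact: sqr_ge0.
- by move=> s; exact: mulr_ge0.
rewrite ES EA => int_le.
have : ((4 * delta * M * (M * x) + 2 * M * M)%:E <=
    (4 * delta * (1 + delta) * M ^+ 2 * p + (M ^+ 2 * (1 + rho)) + M ^+ 2)%:E)%E.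
  apply: (@le_trans _ _ ((4 * delta * M)%:E * (\int[P]_s (S s * \1_A s)%:E) +
      (2 * M)%:E * M%:E + 0%:E)%E).
    by rewrite adde0 EFinD !EFinM leeD2r// lee_wpmul2l.
  apply: (le_trans int_le); rewrite 2!EFinD EFinM leeD2r// leeD2l// mul1e.
  exact: ES2.
rewrite lee_fin => h.
have M20 : 0 < M ^+ 2 by rewrite exprn_gt0.
have : (4 * delta * x + 2) * M ^+ 2 <=
    (4 * delta * (1 + delta) * p + 2 + rho) * M ^+ 2 by nra.
rewrite ler_pM2r// => h4.
have d40 : 0 < 4 * delta by rewrite mulr_gt0.
rewrite -(ler_pM2l d40) mulrDr [X in _ <= _ + X]mulrC divfK ?gt_eqF//; nra.
Qed.

End mixture_test.

(** * Hölder bumps and their pairwise second moments *)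

Section bump.
Context {R : realType}.
Implicit Types (beta C L x y : R).

(** With s = x + y, a ratio z / s in (0, 1] satisfies z / s <= (z / s)^beta; add the cases z = x and
    z = y. *)
Lemma powR_subadditive beta x y : 0 < beta <= 1 -> 0 <= x -> 0 <= y ->
  (x + y) `^ beta <= x `^ beta + y `^ beta.
Proof.
move=> /andP[b0 b1]; rewrite le_eqVlt => /predU1P[<-|x0].
  by rewrite add0r lerDr powR_ge0.
rewrite le_eqVlt => /predU1P[<-|y0]; first by rewrite addr0 lerDl powR_ge0.
have s0 : 0 < x + y by rewrite addr_gt0.
have le_pow z : 0 < z <= x + y -> z / (x + y) * (x + y) `^ beta <= z `^ beta.
  move=> /andP[z0 zs]; rewrite -{2}(divfK (lt0r_neq0 s0) z) powRM; last 2 first.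
  - by rewrite divr_ge0// ltW.
  - exact: ltW.
  rewrite ler_pM2r ?powR_gt0// ger1_powR// divr_gt0//=.
  by rewrite ler_pdivrMr// mul1r.
apply: le_trans (lerD (le_pow x _) (le_pow y _)).
- by rewrite -mulrDl -mulrDl mulfV ?mul1r// gt_eqF.
- by rewrite x0 lerDl ltW.
- by rewrite y0 lerDr ltW.
Qed.

Variable n : nat.
Hypothesis nl : 0 < n%:R / ln (ln n%:R) :> R.

Definition bump C L beta x : R :=
  Num.max 0 (C * rate n beta - L * `|x| `^ beta).

Lemma bump_unimodal C L beta : 0 < L -> 0 < beta -> unimodal_class (bump C L beta).
Proof.
move=> L0 b0.
suff H x y : `|x| <= `|y| -> bump C L beta y <= bump C L beta x.
  split=> x y xy z0; apply: H.
    by rewrite !ler0_norm ?(le_trans xy)// lerN2.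
  by rewrite !ger0_norm ?(le_trans xy)//; apply: le_trans xy.
move=> xy; rewrite /bump ge_max !le_max lexx/= lerB ?orbT//.
by rewrite ler_pM2l// ge0_ler_powR ?nnegrE ?normr_ge0 ?(ltW b0).
Qed.

Lemma bump_holder C L beta : 0 < L -> 0 < beta <= 1 ->
  holder_class L beta (bump C L beta).
Proof.
move=> L0 /andP[b0 b1] x y.
wlog xy : x y / bump C L beta y <= bump C L beta x.
  move=> H; have [|/ltW] := leP (bump C L beta y) (bump C L beta x); first exact: H.
  by move=> /H; rewrite distrC (distrC y).
rewrite ger0_norm ?subr_ge0// lerBlDr /bump ge_max; apply/andP; split.
  by rewrite addr_ge0 ?mulr_ge0 ?powR_ge0 ?(ltW L0)// le_max lexx.
apply: (@le_trans _ _ (L * `|x - y| `^ beta + (C * rate n beta - L * `|y| `^ beta))).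
  have key : `|y| `^ beta <= `|x - y| `^ beta + `|x| `^ beta.
    apply: le_trans (powR_subadditive _ _ _); rewrite ?b0//.
    rewrite ge0_ler_powR ?nnegrE ?addr_ge0 ?(ltW b0)//.
    by rewrite -lerBlDr distrC lerB_dist.
  by have := ler_wpM2l (ltW L0) key; rewrite mulrDr; lra.
by rewrite lerD2l le_max lexx orbT.
Qed.

Lemma bump_le C L beta x : 0 <= C -> 0 <= L -> bump C L beta x <= C * rate n beta.
Proof.
move=> C0 L0; rewrite /bump ge_max mulr_ge0 ?powR_ge0//=.
by rewrite gerBl mulr_ge0// powR_ge0.
Qed.

Lemma bump_ge0 C L beta x : 0 <= bump C L beta x.
Proof. by rewrite /bump le_max lexx. Qed.

Lemma bump_center C L beta : 0 <= C -> 0 < beta -> bump C L beta 0 = C * rate n beta.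
Proof.
move=> C0 b0; rewrite /bump normr0 powR0 ?gt_eqF// mulr0 subr0 max_r//.
by rewrite mulr_ge0// powR_ge0.
Qed.

(** At the bandwidth t one has L t^beta = L r >= C r, r being the rate, so the truncation has taken
    over. *)
Lemma bump_support C L beta x : 0 <= C <= L -> 0 < beta ->
  bandwidth n beta <= `|x| -> bump C L beta x = 0.
Proof.
move=> /andP[C0 CL] b0 tx; rewrite /bump max_l// subr_le0.
apply: ler_pM => //; first by rewrite powR_ge0.
by rewrite -bandwidth_powR// ge0_ler_powR ?nnegrE ?expR_ge0 ?normr_ge0 ?(ltW b0).
Qed.

(* With [w beta = 1 / (2 beta + 1)], the exponents of [ln (n / ln ln n)] on the left add up
   to [- (w b1 - w b2) / 2]. *)
Lemma bandwidth_cross (b1 b2 : R) : 0 <= b1 -> 0 <= b2 -> 0 < ln (ln n%:R) :> R ->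
  n%:R * (rate n b1 * rate n b2) * bandwidth n b1 =
  ln (ln n%:R) * expR (- (lograte n * ((2 * b1 + 1)^-1 - (2 * b2 + 1)^-1) / 2)).
Proof.
move=> b10 b20 l0.
have nE : n%:R = ln (ln n%:R) * expR (lograte n) :> R.
  by rewrite lnK ?posrE// mulrC divfK// gt_eqF.
rewrite {1}nE !rateE// /bandwidth -expRD -!mulrA -!expRD; congr (_ * expR _).
by field; apply/andP; split; rewrite gt_eqF//; lra.
Qed.

End bump.

Section lower_bound.
Context {R : realType}.
Implicit Types (F : cumulativeBounded (0%R : R) (1%R : R)) (v : {mfun R >-> R}).
Implicit Types (eta L : R).

(** The bound [L] keeps each bump inside its bandwidth. The bound [eta / 4] gives 2 C^2 / eta^2 <=
    1/8, hence second moments at most (ln n)^(1/8). *)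
Definition lower_constant eta L : R := Num.min L (eta / 4).

Definition tilt_of v eta L n beta x : R :=
  bump n (lower_constant eta L) L beta x / v x.

Lemma lower_constantP eta L : 0 < eta -> 0 < L ->
  [/\ 0 < lower_constant eta L, lower_constant eta L <= L &
      lower_constant eta L <= eta / 4].
Proof.
move=> eta0 L0; rewrite /lower_constant; split.
- by rewrite lt_min L0 divr_gt0.
- by rewrite ge_min lexx.
- by rewrite ge_min lexx orbT.
Qed.

(** The two bounds on [F] at one point are compatible only if eta <= 1 / eta. *)
Lemma local_bounds_le1 F v eta : 0 < eta -> local_bounds eta F v -> eta <= 1.
Proof.
move=> eta0 [/(_ (eta / 2)) h _].
have /h/andP[h1 h2] : 0 < eta / 2 < eta by apply/andP; split; lra.
have e : eta / 2 / eta = 2^-1 by field; rewrite gt_eqF.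
by have := le_trans h1 h2; rewrite e; nra.
Qed.

Lemma measurable_tilt_of v eta L n beta : (forall x, 0 <= v x) -> 0 < L -> 0 < beta ->
  measurable_fun [set: R] (tilt_of v eta L n beta).
Proof.
move=> v0 L0 b0; rewrite (_ : tilt_of _ _ _ _ _ =
    (fun x => bump n (lower_constant eta L) L beta x * v x `^ (-1))).
  apply: measurable_funM.
    by apply: unimodal_measurable; exact: bump_unimodal.
  exact: (measurableT_comp (measurable_powR (-1))).
by apply/funext => x; rewrite powR_inv1.
Qed.

(** Within the bandwidth [v] is at least [eta], so the division is genuine; beyond it the bump is 0,
    whatever [v] is. *)
Lemma tilt_ofE F v eta L n beta x : 0 < eta -> 0 < L -> local_bounds eta F v ->
  0 < n%:R / ln (ln n%:R) :> R -> 0 < beta -> bandwidth n beta < eta ->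
  tilt_of v eta L n beta x * v x = bump n (lower_constant eta L) L beta x.
Proof.
move=> eta0 L0 FvE nl b0 te; have [C0 CL _] := lower_constantP eta0 L0.
rewrite /tilt_of; have [tx|xt] := leP (bandwidth n beta) `|x|.
  by rewrite bump_support ?mul0r ?(ltW C0).
have [_ /(_ x (lt_trans xt te))/andP[vx _]] := FvE.
by rewrite divfK// gt_eqF// (lt_le_trans eta0).
Qed.

(** The smaller smoothness has the smaller bandwidth, so after ordering [b1 <= b2] the overlap lies
    within the bandwidth of [b1], and [bandwidth_cross] evaluates the exponent. The assumption on
    expR (- (lograte n / 3)) concerns the largest bandwidth, at smoothness 1. *)
Lemma bump_second_moment F v eta L n b1 b2 : (forall x, 0 <= v x) ->
  0 < eta -> 0 < L -> local_bounds eta F v -> 0 < b1 <= 1 -> 0 < b2 <= 1 ->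
  0 < n%:R / ln (ln n%:R) :> R -> 0 < ln (ln n%:R) :> R ->
  0 <= lograte n :> R -> expR (- (lograte n / 3)) < eta ->
  (\int[iid_law (pair_law F v) n]_s
    (likelihood v (tilt_of v eta L n b1) s * likelihood v (tilt_of v eta L n b2) s)%:E <=
  (expR (ln (ln n%:R) / 8 *
    expR (- (lograte n * `|(2 * b1 + 1)^-1 - (2 * b2 + 1)^-1| / 2))))%:E)%E.
Proof.
move=> v0 eta0 L0 FvE; have [C0 CL Ceta] := lower_constantP eta0 L0.
have eta1 := local_bounds_le1 eta0 FvE.
set C := lower_constant eta L in C0 CL Ceta.
wlog b12 : b1 b2 / b1 <= b2.
  move=> H b1P b2P nl l0 lam0 te; have [/H|/ltW/H] := leP b1 b2; first exact.
  move=> /(_ b2P b1P nl l0 lam0 te); rewrite distrC.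
  by under eq_integral do rewrite mulrC.
move=> /andP[b10 b11] /andP[b20 b21] nl l0 lam0 te.
have t_eta (b : R) : 0 < b <= 1 -> bandwidth n b < eta.
  move=> /andP[b0 bb1]; apply: le_lt_trans te; rewrite ler_expR lerN2.
  by rewrite ler_wpM2l// lef_pV2 ?posrE; lra.
have t12 : bandwidth n b1 <= bandwidth n b2.
  rewrite ler_expR lerN2 ler_wpM2l// lef_pV2 ?posrE; lra.
have r1 (b : R) : 0 < b -> rate n b <= 1.
  move=> b0; rewrite rateE//. apply: (@le_trans _ _ (expR 0)); last by rewrite expR0.
  by rewrite ler_expR oppr_le0 mulr_ge0// divr_ge0//; lra.
have rp (b : R) : 0 < rate n b by rewrite rateE// expR_gt0.
pose u := C ^+ 2 * (rate n b1 * rate n b2) / eta.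
have C2 : C ^+ 2 <= eta ^+ 2 / 16 by nra.
have rr1 : rate n b1 * rate n b2 <= 1.
  by rewrite -[leRHS]mulr1 ler_pM ?r1// ltW.
have rr0 : 0 <= rate n b1 * rate n b2 by rewrite mulr_ge0 ?ltW.
have u0 : 0 <= u by rewrite divr_ge0 ?mulr_ge0 ?sqr_ge0// ltW.
have u1 : u <= 2^-1.
  rewrite /u ler_pdivrMr//.
  apply: (@le_trans _ _ (C ^+ 2)); first by rewrite ler_piMr// sqr_ge0.
  apply: (le_trans C2); nra.
apply: (le_trans (integral_likelihoodM v0 n _ _ FvE eta0 (u := u) (h := bandwidth n b1) _ _ _ _)).
- exact: measurable_tilt_of.
- exact: measurable_tilt_of.
- by rewrite u0.
- by rewrite expR_gt0 t_eta// b10.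
- move=> x xt; rewrite -mulrA (tilt_ofE x eta0 L0 FvE nl b20) ?t_eta ?b20// /tilt_of /u.
  have [_ /(_ x (lt_trans xt (t_eta _ _)))] := FvE; rewrite b10 b11 => /(_ isT)/andP[vx _].
  have vx0 : 0 < v x by exact: lt_le_trans vx.
  rewrite mulrAC ler_pdivrMr// [leRHS]mulrAC ler_pdivlMr//.
  apply: ler_pM; rewrite ?mulr_ge0 ?bump_ge0 ?(ltW eta0)//.
  by rewrite expr2 mulrACA; apply: ler_pM; rewrite ?bump_ge0// bump_le// ltW.
- move=> x tx; rewrite /tilt_of bump_support ?mul0r// ?(ltW C0)//.
rewrite lee_fin ler_expR.
have w12 : (2 * b2 + 1)^-1 <= (2 * b1 + 1)^-1 by rewrite lef_pV2 ?posrE; lra.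
rewrite ger0_norm ?subr_ge0//.
have := bandwidth_cross nl (ltW b10) (ltW b20) l0.
set X := expR _; set h := bandwidth n b1 => crossE.
have -> : n%:R * (2 * u * (h / eta)) =
    2 * C ^+ 2 / eta ^+ 2 * (n%:R * (rate n b1 * rate n b2) * h).
  by rewrite /u; field; rewrite gt_eqF.
rewrite crossE.
rewrite mulrA ler_pM2r ?expR_gt0// [leRHS]mulrC ler_pM2r// ler_pdivrMr ?exprn_gt0//.
have := C2; lra.
Qed.

End lower_bound.

(** * The grid of smoothness levels *)

Section grid.
Context {R : realType}.
Implicit Types (F : cumulativeBounded (0%R : R) (1%R : R)) (v : {mfun R >-> R}).
Implicit Types (eta L : R).

Definition beta_grid (bl bu : R) m (i : 'I_m) : R := bl + (bu - bl) * (i%:R / m%:R).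

Lemma beta_grid_bounds (bl bu : R) m (i : 'I_m) : bl <= bu ->
  bl <= beta_grid bl bu i <= bu.
Proof.
move=> b; have m0 : 0 < m%:R :> R by rewrite ltr0n (leq_ltn_trans _ (ltn_ord i)).
have i0 : 0 <= i%:R / m%:R :> R by rewrite divr_ge0.
have i1 : i%:R / m%:R <= 1 :> R by rewrite ler_pdivrMr// mul1r ler_nat ltnW.
by rewrite /beta_grid; apply/andP; split; nra.
Qed.

(** The derivative of 1 / (2 b + 1) has absolute value 2 / (2 b + 1)^2, at least 2/9 for b <= 1. *)
Lemma beta_grid_sep (bl bu : R) m (i j : 'I_m) : 0 < bl -> bl < bu -> bu <= 1 ->
  i != j -> 2 * (bu - bl) / 9 / m%:R <=
  `|(2 * beta_grid bl bu i + 1)^-1 - (2 * beta_grid bl bu j + 1)^-1|.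
Proof.
move=> bl0 blu bu1; wlog ij : i j / (j < i)%N.
  move=> H ij; have [ji|ji|/val_inj ji] := ltngtP j i.
  - exact: H.
  - by rewrite distrC; apply: H => //; rewrite eq_sym.
  - by rewrite ji eqxx in ij.
move=> _; have m0 : 0 < m%:R :> R by rewrite ltr0n (leq_ltn_trans _ (ltn_ord i)).
have /andP[bi bi'] := beta_grid_bounds i (ltW blu).
have /andP[bj bj'] := beta_grid_bounds j (ltW blu).
have dij : (bu - bl) / m%:R <= beta_grid bl bu i - beta_grid bl bu j.
  have -> : beta_grid bl bu i - beta_grid bl bu j = (bu - bl) / m%:R * (i%:R - j%:R).
    by rewrite /beta_grid; ring.
  rewrite ler_peMr// ?divr_ge0 ?subr_ge0 ?(ltW blu)//.
  by rewrite lerBrDr nat1r ler_nat.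
set x := beta_grid bl bu i in bi bi' dij *; set y := beta_grid bl bu j in bj bj' dij *.
have q0 : 0 < (bu - bl) / m%:R by rewrite divr_gt0// subr_gt0.
rewrite distrC ger0_norm; last by rewrite subr_ge0 lef_pV2 ?posrE; lra.
have -> : (2 * y + 1)^-1 - (2 * x + 1)^-1 = 2 * (x - y) / ((2 * y + 1) * (2 * x + 1)).
  by field; apply/andP; split; rewrite gt_eqF//; lra.
rewrite (_ : 2 * _ / 9 / _ = 2 * ((bu - bl) / m%:R) / 9); last by field; rewrite gt_eqF.
rewrite ler_pdivlMr; last by rewrite mulr_gt0//; lra.
set q := (bu - bl) / m%:R in dij q0 *.
have : (2 * y + 1) * (2 * x + 1) <= 9 by nra.
nra.
Qed.

Lemma grid_second_moment F v eta L (bl bu rho : R) : (forall x, 0 <= v x) ->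
  0 < eta -> 0 < L -> local_bounds eta F v -> 0 < bl -> bl < bu -> bu <= 1 ->
  0 < rho -> \forall n \near \oo, exists2 m : nat, (0 < m)%N &
  (\sum_(i < m) \sum_(j < m) \int[iid_law (pair_law F v) n]_s
    (likelihood v (tilt_of v eta L n (beta_grid bl bu i)) s *
     likelihood v (tilt_of v eta L n (beta_grid bl bu j)) s)%:E <=
    (m%:R ^+ 2 * (1 + rho))%:E)%E.
Proof.
move=> v0 eta0 L0 FvE bl0 blu bu1 rho0.
pose c : R := 2 * (bu - bl) / 9.
have c0 : 0 < c by rewrite divr_gt0// mulr_gt0// subr_gt0.
pose r := ln (1 + rho / 2).
have r0 : 0 < r by rewrite ln_gt0// ltrDl divr_gt0.
(* Using exp z >= z^2 / 2 and ln ln n <= 2 y, the off-diagonal exponent is at most 32 / (c^2 y),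
   which is at most [r] as soon as [y >= Y]. *)
pose Y : R := 32 / (c ^+ 2 * r).
have Y0 : 0 < Y by rewrite divr_gt0// mulr_gt0// exprn_gt0.
near=> n.
have n0 : 0 < n%:R :> R by rewrite ltr0n; near: n; exact: nbhs_infty_gt.
have ll1 : 1 <= ln (ln n%:R) :> R by near: n; exact: near_lnln.
have ll0 : 0 < ln (ln n%:R) :> R by exact: lt_le_trans ll1.
have x1 : 1 <= ln n%:R :> R by near: n; exact: near_ln.
have x0 : 0 < ln n%:R :> R by exact: lt_le_trans x1.
have nl : 0 < n%:R / ln (ln n%:R) :> R by rewrite divr_gt0.
have lamx : ln n%:R / 2 <= lograte n :> R by near: n; exact: near_lograte.
have lam_eta : 3 * (1 - ln eta) <= lograte n by near: n; exact: near_lograte_ge.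
have lam0 : 0 <= lograte n :> R by near: n; exact: near_lograte_ge.
have llY : 2 * ln Y <= ln (ln n%:R) by near: n; exact: near_lnln.
have llr : - (8 / 3 * ln (rho / 2)) <= ln (ln n%:R) by near: n; exact: near_lnln.
have te : expR (- (lograte n / 3)) < eta.
  by rewrite -[ltRHS]lnK ?posrE// ltr_expR; lra.
set ll := ln (ln n%:R) in ll1 ll0 nl llY llr *.
pose y := expR (ll / 2).
have y1 : 1 <= y by rewrite /y -[leLHS]expR0 ler_expR divr_ge0// ltW.
have y0 : 0 < y by exact: lt_le_trans y1.
have yx : y ^+ 2 = ln n%:R.
  by rewrite /y -expRM_natl mulrC divfK// lnK// posrE.
have Yy : Y <= y.
  by rewrite -[leLHS]lnK ?posrE// ler_expR ler_pdivlMr// mulrC.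
have lly : ll <= 2 * y.
  by have := ln_sublinear y0; rewrite /y expRK; lra.
(* Here y = sqrt (ln n) and y < m <= 2 y: the first bound tames the diagonal, the second keeps grid
   points at least c / (2 y) apart, so the off-diagonal decay is exp (- c y / 8). *)
pose m := (Num.truncn y).+1.
have ym : y < m%:R by rewrite truncnS_gt.
have my : m%:R <= 2 * y.
  have /andP[+ _] := truncn_itv (ltW y0); rewrite /m -natr1; lra.
have m0 : 0 < m%:R :> R by rewrite ltr0n.
exists m => //.
pose e := ll / 8 * expR (- (c * y / 8)).
have er : e <= r.
  have z0 : 0 < c * y / 8 by rewrite divr_gt0// mulr_gt0.
  have h1 : (c * y / 8) ^+ 2 / 2 <= expR (c * y / 8).
    by have := expR_ge1Dxn 1 (ltW z0); rewrite !factS fact0 !muln1; lra.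
  have h2 : expR (- (c * y / 8)) <= ((c * y / 8) ^+ 2 / 2)^-1.
    by rewrite expRN lef_pV2 ?posrE ?expR_gt0// divr_gt0// exprn_gt0.
  apply: (@le_trans _ _ (2 * y / 8 * ((c * y / 8) ^+ 2 / 2)^-1)).
    apply: ler_pM; [by rewrite divr_ge0// ltW|exact: expR_ge0| |exact: h2].
    by rewrite ler_pM2r.
  rewrite (_ : _ * _ = 32 / c ^+ 2 / y); last first.
    by field; apply/andP; split; rewrite gt_eqF.
  rewrite ler_pdivrMr// -ler_pdivrMl//; apply: le_trans Yy.
  rewrite /Y le_eqVlt; apply/predU1P; left; field.
  by apply/andP; split; rewrite gt_eqF.
have diag : expR (ll / 8) <= m%:R * (rho / 2).
  apply: (@le_trans _ _ (y * (rho / 2))); last first.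
    by rewrite ler_pM2r ?divr_gt0// ltW.
  rewrite -[X in _ <= _ * X]lnK ?posrE ?divr_gt0// -expRD ler_expR; lra.
have off : expR e <= 1 + rho / 2.
  by rewrite -[leRHS]lnK ?posrE ?addr_gt0 ?divr_gt0// ler_expR.
have grid_in (i : 'I_m) : 0 < beta_grid bl bu i <= 1.
  by have /andP[h1 h2] := beta_grid_bounds i (ltW blu); apply/andP; split; lra.
apply: (@le_trans _ _ (\sum_(i < m) \sum_(j < m)
    ((i == j)%:R * expR (ll / 8) + expR e)%:E)%E).
  apply: lee_sum => i _; apply: lee_sum => j _.
  apply: (le_trans (bump_second_moment v0 eta0 L0 FvE (grid_in i) (grid_in j)
    nl ll0 lam0 te)).
  rewrite lee_fin -/ll; have [->|ij] := eqVneq i j.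
    by rewrite subrr normr0 mulr0 mul0r oppr0 expR0 mulr1 mul1r lerDl expR_ge0.
  rewrite mul0r add0r ler_expR ler_wpM2l ?divr_ge0 ?(ltW ll0)// ler_expR lerN2.
  have sep := beta_grid_sep bl0 blu bu1 ij; set w := `|_| in sep *.
  rewrite -/c in sep.
  have : c / (2 * y) <= w.
    apply: le_trans sep; rewrite ler_pM2l// lef_pV2 ?posrE ?mulr_gt0//.
  rewrite ler_pdivrMr ?mulr_gt0// => cw.
  have w0 : 0 <= w by exact: normr_ge0.
  have : ln n%:R / 2 * w <= lograte n * w by rewrite ler_wpM2r.
  rewrite -yx; nra.
under eq_bigr do rewrite sumEFin big_split/= sumr_const card_ord.
under eq_bigr do rewrite -mulr_suml -natr_sum.
rewrite sumEFin lee_fin big_split/= sumr_const card_ord.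
have sum1 (i : 'I_m) : (\sum_(j < m) (i == j))%N = 1%N.
  by rewrite (bigD1 i)//= eqxx big1// => j ji; rewrite eq_sym (negbTE ji).
under eq_bigr do rewrite sum1 mul1r.
rewrite sumr_const card_ord -[X in X + _]mulr_natl -[X in _ + X *+ _]mulr_natl.
rewrite -[X in _ + X]mulr_natl.
have := ler_wpM2l (ltW m0) diag.
have := ler_wpM2l (ltW m0) (ler_wpM2l (ltW m0) off).
by rewrite expr2; lra.
Unshelve. all: by end_near. Qed.

End grid.

(** * Limits inferior and superior *)

Section limsup.
Context {R : realType}.
Implicit Types (u : (\bar R)^nat) (l : \bar R).

Lemma limn_esup_le_near u l :
  (\forall n \near \oo, (u n <= l)%E) -> (limn_esup u <= l)%E.
Proof.
move=> ul; rewrite /limn_esup limf_esupE.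
apply: (@le_trans _ _ (ereal_sup [set u x | x in [set n | (u n <= l)%E]])).
  by apply: ereal_inf_lbound; exists [set n | (u n <= l)%E].
by apply: ge_ereal_sup => _ [n /= un <-].
Qed.

Lemma limn_einf_gt_near u (x e : R) : 0 < e -> (x%:E <= limn_einf u)%E ->
  \forall n \near \oo, ((x - e)%:E <= u n)%E.
Proof.
move=> e0; rewrite /limn_einf leeNr => h.
have : (limn_esup (\- u) < (- (x - e))%:E)%E.
  by apply: (le_lt_trans h); rewrite -EFinN lte_fin ltrN2 ltrBlDr ltrDl.
rewrite /limn_esup limf_esupE => /ereal_inf_lt[_ [V Voo <-]] supV.
apply: filterS Voo => n Vn.
rewrite -leeN2 -EFinN; apply: le_trans (ltW supV).
by apply: ereal_sup_ubound; exists n.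
Qed.

Lemma cvg_near_ub u l : (forall n, (u n <= l)%E) -> l \is a fin_num ->
  (forall e : R, 0 < e -> \forall n \near \oo, (l - e%:E <= u n)%E) ->
  u @ \oo --> l.
Proof.
move=> ul lfin ule; rewrite -[l]oppeK (_ : u = \- (\- u))%E; last first.
  by apply/funext => n; rewrite oppeK.
apply: cvgeN; apply: limn_esup_le_cvg => [|n]; last by rewrite leeN2.
apply/lee_addgt0Pr => e e0; apply: limn_esup_le_near.
apply: filterS (ule e e0) => n h.
by rewrite -leeN2 oppeK fin_num_oppeD// oppeK.
Qed.

End limsup.

Section corollary.
Context {R : realType}.
Implicit Types (F : cumulativeBounded (0%R : R) (1%R : R)) (v : {mfun R >-> R}).
Implicit Types (eta L : R).

Lemma Prob_le1 F v (g : R -> R) n (A : set (n.-tuple (R * R))) :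
  measurable_fun [set: R] g -> measurable A -> (Prob F v g A <= 1)%E.
Proof.
move=> mg mA; apply: probability_le1.
by rewrite -[X in measurable X]setTI; exact: measurable_observations.
Qed.

(** Each bump has height at 0 exactly [lower_constant eta L * rate n beta], so the shifted threshold
    is 0 for all of them. Every event in question becomes the same event [0 < c n s], which coverage
    at [g = 0] makes improbable. *)
Lemma lower_bound F v eta L (bl bu alpha : R)
    (c : forall n : nat, n.-tuple (R * R) -> \bar R) :
  0 < eta -> 0 < L -> 0 < bl -> bl < bu -> bu <= 1 ->
  (forall x, 0 <= v x) -> local_bounds eta F v ->
  (forall n, measurable_fun [set: n.-tuple (R * R)] (c n)) ->
  ((1 - alpha)%:E <= limn_einf (fun n =>
     ereal_inf [set Prob F v g [set s | c n s <= (g 0%R)%:E]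
               | g in unimodal_class]))%E ->
  (limn_esup (fun n =>
     ereal_inf [set
       ereal_inf [set Prob F v g
                    [set s | (g 0%R - lower_constant eta L * rate n beta)%:E < c n s]
                 | g in holder_class L beta `&` unimodal_class]
       | beta in `[bl, bu]%classic])
   <= alpha%:E)%E.
Proof.
move=> eta0 L0 bl0 blu bu1 v0 FvE mc cover.
apply/lee_addgt0Pr => e e0; apply: limn_esup_le_near.
have [C0 CL _] := lower_constantP eta0 L0.
(* The excess over [alpha] splits into three parts: d from coverage, at most d from the factor 1 +
   d, and rho / (4 d) = d for rho = 4 d^2. *)
pose d := e / 3; have d0 : 0 < d by rewrite divr_gt0.
near=> n.
have [m m0 second] : exists2 m : nat, (0 < m)%N &
    (\sum_(i < m) \sum_(j < m) \int[iid_law (pair_law F v) n]_s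
      (likelihood v (tilt_of v eta L n (beta_grid bl bu i)) s *
       likelihood v (tilt_of v eta L n (beta_grid bl bu j)) s)%:E <=
    (m%:R ^+ 2 * (1 + 4 * d ^+ 2))%:E)%E.
  near: n; apply: grid_second_moment => //.
  by rewrite mulr_gt0// exprn_gt0.
have cov : (((1 - alpha) - d)%:E <= ereal_inf
    [set Prob F v g [set s : n.-tuple (R * R) | (c n s <= (g 0%R)%:E)%E]
    | g in unimodal_class])%E.
  by near: n; exact: limn_einf_gt_near.
have nR : 0 < n%:R :> R by rewrite ltr0n; near: n; exact: nbhs_infty_gt.
have ll0 : 1 <= ln (ln n%:R) :> R by near: n; exact: near_lnln.
have nl : 0 < n%:R / ln (ln n%:R) :> R by rewrite divr_gt0// (lt_le_trans ltr01).
have lam_eta : 3 * (1 + `|ln eta|) <= lograte n by near: n; exact: near_lograte_ge.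
have lam0 : 0 <= lograte n :> R by near: n; exact: near_lograte_ge.
set u := ereal_inf _.
pose A : set (n.-tuple (R * R)) := [set s | (0%:E < c n s)%E].
have mA : measurable A.
  by rewrite /A -[X in measurable X]setTI; exact: emeasurable_fun_o_infty.
have grid_in (i : 'I_m) : bl <= beta_grid bl bu i <= bu.
  by apply: beta_grid_bounds; exact: ltW.
have te (i : 'I_m) : bandwidth n (beta_grid bl bu i) < eta.
  rewrite -[ltRHS]lnK ?posrE// ltr_expR; have /andP[h1 h2] := grid_in i.
  rewrite ltrNl ltr_pdivlMr; last lra.
  apply: (@le_lt_trans _ _ (`|ln eta| * 3)); last by lra.
  apply: (@le_trans _ _ (`|ln eta| * (2 * beta_grid bl bu i + 1))).
    by rewrite ler_pM2r; [rewrite -normrN ler_norm|lra].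
  by rewrite ler_wpM2l//; lra.
have uP (i : 'I_m) : (u <= Prob F v
    (bump n (lower_constant eta L) L (beta_grid bl bu i)) A)%E.
  have /andP[h1 h2] := grid_in i.
  have b0 : 0 < beta_grid bl bu i by lra.
  apply: (@le_trans _ _ (ereal_inf [set Prob F v g
      [set s : n.-tuple (R * R) |
        ((g 0%R - lower_constant eta L * rate n (beta_grid bl bu i))%:E < c n s)%E]
      | g in holder_class L (beta_grid bl bu i) `&` unimodal_class])).
    by apply: ereal_inf_lbound; exists (beta_grid bl bu i) => //=; rewrite in_itv/= h1.
  apply: ereal_inf_lbound; exists (bump n (lower_constant eta L) L (beta_grid bl bu i)).
    split; last exact: bump_unimodal.
    by apply: bump_holder => //; rewrite b0 (le_trans h2).
  by rewrite bump_center ?(ltW C0)// subrr.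
have u0 : (0 <= u)%E.
  by apply: le_ereal_inf_tmp => _ [b _ <-]; apply: le_ereal_inf_tmp => _ [g _ <-].
have ufin : u \is a fin_num.
  rewrite ge0_fin_numE// (le_lt_trans (uP (Ordinal m0)))//.
  rewrite (le_lt_trans (Prob_le1 F v _ mA)) ?ltry//.
  apply: unimodal_measurable; apply: bump_unimodal => //.
  by apply: (lt_le_trans bl0); have /andP[] := grid_in (Ordinal m0).
have Afin : iid_law (pair_law F v) n A \is a fin_num by exact: fin_num_measure.
have PA : (iid_law (pair_law F v) n A <= (alpha + d)%:E)%E.
  (* The zero function is unimodal, so coverage applies to it. *)
  have cov0 : (((1 - alpha) - d)%:E <= iid_law (pair_law F v) n (~` A))%E.
    apply: (le_trans cov); apply: ereal_inf_lbound; exists (fun=> 0) => //.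
    rewrite /Prob; congr (iid_law _ _ _); apply/seteqP; split => s /=.
      by rewrite observations0 leNgt => /negP.
    by rewrite observations0 leNgt => /negP.
  move: cov0; rewrite probability_setC// -(fineK Afin) -EFinB !lee_fin; lra.
have p1 : fine (iid_law (pair_law F v) n A) <= 1.
  by rewrite -lee_fin fineK//; exact: probability_le1.
have pa : fine (iid_law (pair_law F v) n A) <= alpha + d by rewrite -lee_fin fineK.
rewrite -(fineK ufin) -EFinD lee_fin.
have mix : fine u <= (1 + d) * fine (iid_law (pair_law F v) n A) + 4 * d ^+ 2 / (4 * d).
  apply: (@mixture_test_bound R F v v0 m n
    (fun i => tilt_of v eta L n (beta_grid bl bu i))
    (fun i => bump n (lower_constant eta L) L (beta_grid bl bu i)) A) => //.
  - move=> i; apply: measurable_tilt_of => //.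
    by apply: (lt_le_trans bl0); have /andP[] := grid_in i.
  - move=> i; apply: unimodal_measurable; apply: bump_unimodal => //.
    by apply: (lt_le_trans bl0); have /andP[] := grid_in i.
  - move=> i x; apply: (tilt_ofE _ eta0 L0 FvE nl _ (te i)).
    by apply: (lt_le_trans bl0); have /andP[] := grid_in i.
  - by move=> i; rewrite fineK.
  - by rewrite fineK.
apply: (le_trans mix).
rewrite (_ : 4 * d ^+ 2 / (4 * d) = d); last by field; rewrite gt_eqF.
have : d * fine (iid_law (pair_law F v) n A) <= d by rewrite ler_piMr// ltW.
rewrite (_ : e = 3 * d); last by rewrite /d; field.
by lra.
Unshelve. all: by end_near. Qed.

End corollary.

Theorem corollary3p1 (R : realType) :
  (forall L betal betau eta : R,
    0 < L -> 0 < betal -> betal < betau -> betau <= 1 -> 0 < eta ->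
    exists2 Clow : R, 0 < Clow &
    forall (F : cumulativeBounded (0 : R) (1 : R)) (v : {mfun R >-> R})
      (alpha : R) (c : forall n : nat, n.-tuple (R * R) -> \bar R),
    (forall x, 0 <= v x) -> local_bounds eta F v -> 0 < alpha < 1 ->
    (forall n, measurable_fun [set: n.-tuple (R * R)] (c n)) ->
    ((1 - alpha)%:E <= limn_einf (fun n =>
       ereal_inf [set Prob F v g [set s | c n s <= (g 0%R)%:E]
                 | g in unimodal_class]))%E ->
    (limn_esup (fun n =>
       ereal_inf [set
         ereal_inf [set Prob F v g
                      [set s | (g 0%R - Clow * rate n beta)%:E < c n s]
                   | g in holder_class L beta `&` unimodal_class]
         | beta in `[betal, betau]%classic])
     <= alpha%:E)%E)
  /\
  (forall (L eta : R) (F : cumulativeBounded (0 : R) (1 : R))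
     (v : {mfun R >-> R}) (alpha : R),
    0 < L -> 0 < eta -> (forall x, 0 <= v x) -> local_bounds eta F v ->
    0 < alpha < 1 ->
    (forall (n : nat) (g : R -> R), (0 < n)%N -> unimodal_class g ->
       ((1 - alpha)%:E <=
        Prob F v g [set s : n.-tuple (R * R) |
                     chat_star eta F v alpha s <= (g 0%R)%:E])%E) /\
    exists Cup : R, forall eps : R, 0 < eps <= 1 ->
      (fun n : nat =>
         ereal_inf [set
           ereal_inf [set Prob F v g [set s : n.-tuple (R * R) |
                        ((g 0%R - Cup * rate n beta)%:E
                         < chat_star eta F v alpha s)%E]
                     | g in holder_class L beta `&` unimodal_class]
           | beta in `[eps, 1%R]%classic]) @ \oo --> 1%E).
Proof.
split.
  move=> L bl bu eta L0 bl0 blu bu1 eta0; exists (lower_constant eta L).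
    by have [] := lower_constantP eta0 L0.
  move=> F v alpha c v0 FvE alpha01 mc cover.
  exact: lower_bound.
move=> L eta F v alpha L0 eta0 v0 FvE alpha01; split.
  by move=> n g n0 ug; exact: chat_star_coverage.
(* The constant is chosen before [eps]; only the threshold on [n] depends on [eps]. *)
exists (upper_constant eta L) => eps eps01; have /andP[eps0 eps1] := eps01.
apply: cvg_near_ub => // [n|d d0].
  (* The infimum over an empty set would be [+oo]; it is at most 1 because smoothness 1 and the zero
     function are admissible. *)
  apply: (@le_trans _ _ (ereal_inf [set Prob F v g [set s : n.-tuple (R * R) |
      ((g 0%R - upper_constant eta L * rate n 1)%:E < chat_star eta F v alpha s)%E]
      | g in holder_class L 1 `&` unimodal_class])).
    by apply: ereal_inf_lbound; exists 1 => //=; rewrite in_itv/= eps1 lexx.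
  apply: (@le_trans _ _ (Prob F v (fun=> 0) [set s : n.-tuple (R * R) |
      ((0 - upper_constant eta L * rate n 1)%:E < chat_star eta F v alpha s)%E])).
    apply: ereal_inf_lbound; exists (fun=> 0) => //; split => // x y.
    by rewrite subrr normr0 mulr_ge0 ?powR_ge0// ltW.
  apply: Prob_le1 => //; rewrite (_ : [set s | _] =
    ~` [set s : n.-tuple (R * R) | (chat_star eta F v alpha s <=
         (0 - upper_constant eta L * rate n 1)%:E)%E]).
    by apply: measurableC; exact: measurable_chat_star_le.
  by apply/seteqP; split => s /=; rewrite ltNge => /negP.
apply: filterS (chat_star_rate v0 eta0 L0 FvE alpha01 eps01 d0) => n h.
apply: le_ereal_inf_tmp => _ [b /= + <-]; rewrite in_itv/= => bb.
by apply: le_ereal_inf_tmp => _ [g [gL ug] <-]; exact: h.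
Qed.
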